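(* Let $M\in\mathbb{R}\setminus\{0\}$ and let $L,T>0$ be such that $$T<0.33\,\frac{L}{M}\ \text{ if } M>0,\qquad T<1.69\,\frac{L}{|M|}\ \text{ if } M<0.$$ Then there exist constants $c,C>0$ (not depending on $\varepsilon$) such that $$K(\varepsilon,T,L,M)\ge C\exp(c\,\varepsilon^{-1/3})\quad\text{for each }\varepsilon\in(0,1),$$ where $K(\varepsilon,T,L,M)$ is the cost of null controllability defined in the context.
   Context: For $\varepsilon,T,L>0$ and $M\in\mathbb{R}\setminus\{0\}$, put $\delta=-2\varepsilon^{2/3}M^{1/3}$ (real cube root), $By=\varepsilon y_{xx}+\frac{\delta}{2}y_x$ and $B^*\varphi=\varepsilon\varphi_{xx}-\frac{\delta}{2}\varphi_x$. Consider the control system $$\begin{cases} y_t+\varepsilon y_{xxxx}+\delta y_{xxx}+My_x=0, & (t,x)\in(0,T)\times(0,L),\\ y(t,0)=0,\quad y(t,L)=0, & t\in(0,T),\\ By(t,0)=u(t),\quad By(t,L)=0, & t\in(0,T),\\ y(0,x)=y_0(x), & x\in(0,L).\end{cases}$$ Solutions are defined by transposition. For $t\in(0,T]$ and $\varphi_0\in L^2(0,L)$, let $\varphi\in C([0,t];L^2(0,L))\cap L^2(0,t;H^2\cap H^1_0(0,L))$ be the solution of the (backward) adjoint system on $(0,t)\times(0,L)$: $$-\varphi_s+\varepsilon\varphi_{xxxx}-\delta\varphi_{xxx}-M\varphi_x=0,\quad \varphi(s,0)=\varphi(s,L)=0,\quad B^*\varphi(s,0)=B^*\varphi(s,L)=0,\quad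 \varphi(t,\cdot)=\varphi_0.$$ Given $y_0\in L^2(0,L)$ and $u\in L^2(0,T)$, a solution of the control system is a function $y=y(t,x)$ such that for every $t\in[0,T]$ one has $y(t,\cdot)\in L^2(0,L)$ and $$\int_0^L y(t,x)\varphi_0(x)\,dx=\int_0^L y_0(x)\varphi(0,x)\,dx+\int_0^t u(s)\varphi_x(s,0)\,ds$$ for every $\varphi_0\in L^2(0,L)$. For each $y_0\in L^2(0,L)$ and $u\in L^2(0,T)$ there is exactly one solution $y\in C([0,T];L^2(0,L))$. For $y_0\in L^2(0,L)$ let $U(\varepsilon,T,L,M,y_0)$ be the set of all $u\in L^2(0,T)$ whose corresponding solution satisfies $y(T,\cdot)=0$ (this set is nonempty). The cost of null controllability is $$K(\varepsilon,T,L,M)=\sup_{\|y_0\|_{L^2(0,L)}\le1}\ \inf\{\|u\|_{L^2(0,T)}: u\in U(\varepsilon,T,L,M,y_0)\}.$$ *)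

(* Defs.v *)
From mathcomp Require Import all_boot all_order all_algebra.
From mathcomp Require Import all_classical all_reals all_analysis.

Set Implicit Arguments.
Unset Strict Implicit.
Unset Printing Implicit Defensive.
Import Order.TTheory GRing.Theory Num.Theory.
Import numFieldNormedType.Exports.
Local Open Scope classical_set_scope.
Local Open Scope ring_scope.

Definition isL2 d (T : measurableType d) (R : realType)
    (mu : {measure set T -> \bar R}) (D : set T) (f : T -> R) : Prop :=
  f \_ D \in Lfun mu 2%:E.

Section FourthOrder.
Context {R : realType}.
Local Notation leb := (@lebesgue_measure R).

(* Functions of (0,L) are represented by functions R -> R whose values outside
   [0,L] are irrelevant; those of (t,x) by curried functions R -> R -> R. *)

Definition L2 (a b : R) (f : R -> R) : Prop := isL2 leb `]a, b[ f.

Definition L2norm (a b : R) (f : R -> R) : \bar R :=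
  'N[leb]_(2%:E)[EFin \o (f \_ `]a, b[)].

(* f is the absolutely continuous representative, on [0,L], of an element of
   H^1(0,L), with weak derivative f1.  In particular f 0 and f L are its
   boundary traces. *)
Definition isH1 (L : R) (f f1 : R -> R) : Prop :=
  L2 0 L f1 /\
  forall x, x \in `[0, L] -> f x = f 0 + \int[leb]_(r in `[0, x]) f1 r.

(* f in H^2 and H^1_0, with weak derivatives f1 = f_x and f2 = f_xx.  As f1 is
   itself the continuous representative, f1 0 is the trace f_x(0). *)
Definition isH2H10 (L : R) (f f1 f2 : R -> R) : Prop :=
  [/\ isH1 L f f1, isH1 L f1 f2, f 0 = 0 & f L = 0].

Definition cbrt (x : R) : R := Num.sg x * `|x| `^ (3%:R^-1).

Definition delta (eps M : R) : R :=
  - 2%:R * eps `^ (2%:R / 3%:R) * cbrt M.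

(* Weak form of phi |-> eps phi_xxxx - delta phi_xxx - M phi_x.  Since this is
   (B^* phi)_xx - (delta/2) phi_xxx - M phi_x, testing it with a psi vanishing
   at 0 and L and integrating by parts, with B^* phi = 0 at 0 and L, gives
     int (B^* phi) psi_xx + (delta/2) phi_xx psi_x - M phi_x psi;
   the conditions on B^* phi are the natural boundary conditions. *)
Definition adjoint_form (eps L M : R) (f1 f2 psi psi1 psi2 : R -> R) : R :=
  \int[leb]_(x in `]0, L[)
    ((eps * f2 x - delta eps M / 2%:R * f1 x) * psi2 x
     + delta eps M / 2%:R * f2 x * psi1 x
     - M * f1 x * psi x).

Definition isL2_rect (t L : R) (f : R -> R -> R) : Prop :=
  isL2 (leb \x leb)%E (`]0, t[ `*` `]0, L[) (fun z => f z.1 z.2).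

(* phi in C([0,t]; L^2) and L^2(0,t; H^2 and H^1_0), with space derivatives
   phi1 and phi2, is the weak solution of the backward adjoint system on
   (0,t) x (0,L) with final datum phi0.  The last clause is the equation
   integrated in time from s to t. *)
Record adjoint_solution (eps L M t : R) (phi0 : R -> R)
    (phi phi1 phi2 : R -> R -> R) : Prop := AdjointSolution {
  adjoint_L2 : forall s, s \in `[0, t] -> L2 0 L (phi s) ;
  adjoint_continuous : forall s, s \in `[0, t] ->
    L2norm 0 L (phi r \- phi s) @[r --> within `[0, t] (nbhs s)] --> 0%E ;
  adjoint_H2H10 : {ae leb, forall s, s \in `]0, t[ ->
    isH2H10 L (phi s) (phi1 s) (phi2 s)} ;
  adjoint_L2H2 :
    [/\ isL2_rect t L phi, isL2_rect t L phi1 & isL2_rect t L phi2] ;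
  adjoint_final : {ae leb, forall x, x \in `]0, L[ -> phi t x = phi0 x} ;
  adjoint_weak : forall psi psi1 psi2 : R -> R, isH2H10 L psi psi1 psi2 ->
    forall s, s \in `[0, t] ->
    \int[leb]_(x in `]0, L[) (phi t x * psi x)
      - \int[leb]_(x in `]0, L[) (phi s x * psi x)
    = \int[leb]_(r in `[s, t])
        adjoint_form eps L M (phi1 r) (phi2 r) psi psi1 psi2
}.

(* For t = 0 the adjoint system reduces to phi 0 = phi0 and the identity says
   that y 0 = y0 a.e. *)
Definition control_solution (eps T L M : R) (y0 u : R -> R)
    (y : R -> R -> R) : Prop :=
  forall t, t \in `[0, T] ->
    L2 0 L (y t) /\
    forall (phi0 : R -> R) (phi phi1 phi2 : R -> R -> R), L2 0 L phi0 ->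
      adjoint_solution eps L M t phi0 phi phi1 phi2 ->
      \int[leb]_(x in `]0, L[) (y t x * phi0 x)
      = \int[leb]_(x in `]0, L[) (y0 x * phi 0 x)
        + \int[leb]_(s in `]0, t[) (u s * phi1 s 0).

Definition null_controls (eps T L M : R) (y0 : R -> R) : set (R -> R) :=
  [set u | L2 0 T u /\ exists y : R -> R -> R,
     control_solution eps T L M y0 u y /\
     {ae leb, forall x, x \in `]0, L[ -> y T x = 0}].

Definition control_cost (eps T L M : R) : \bar R :=
  ereal_sup
    [set ereal_inf [set L2norm 0 T u | u in null_controls eps T L M y0]
    | y0 in [set y0 | L2 0 L y0 /\ (L2norm 0 L y0 <= 1)%E]].

End FourthOrder.

(* Main.v *)
Require Import Defs.
From mathcomp Require Import all_boot all_order all_algebra.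
From mathcomp Require Import all_classical all_reals all_analysis.
From mathcomp Require Import measurable_realfun ring lra.
Import Order.TTheory GRing.Theory Num.Theory.
Import numFieldNormedType.Exports.
Local Open Scope ring_scope.

(** The coefficient delta is such that the spatial operator is a quadratic
    polynomial in one second order operator.  With q the real cube root of M
    divided by 2 eps^(1/3), one has delta = -4 eps q and M = 8 eps q^3, and the
    adjoint system has the explicit modes exp(-qx) sin(kx), for k a multiple of
    pi/L, with decay rate eps (k^2 + q^2) (k^2 + 5 q^2).

    Take as initial datum a multiple of exp(qx) sin(pi x/L), which is orthogonal
    to every adjoint mode but the first.  A null control u for it has vanishing
    moments against exp(nu_k (s - T)) for all rates nu_k but the first, nu_0, and
    a prescribed moment for nu_0 ([null_control_moment]).  So the norm of u is at
    least this moment divided by the distance, in L2(0,T), from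
    exp(nu_0 (s - T)) to the span of the others.  On a half-line that distance
    is classical: relative to the norm of the first exponential, it is the product
    of the factors (nu_k - nu_0)/(nu_k + nu_0), because the Gram matrix is a Cauchy
    matrix.  The extremal combination comes from a partial fraction expansion
    ([partial_fractions], [cauchy_form_extremal]), and finitely many moments
    suffice for each eps.  One may first add a shift a >= 0 to all rates: this costs
    a factor exp(aT), but on the half-line it gives the factors
    (nu_k - nu_0)/(nu_k + nu_0 + 2a), which are smaller ([moment_bound]).

    The scale of the problem is m = 2|q|, that is |M|^(1/3) eps^(-1/3).  At the
    wavenumber mx the rate is |M| m (x^4 + 3x^2/2 + 5/16), and the wavenumbers
    are spaced by t = pi/(Lm) in the variable x.  Hence, with a = al |M| m, the
    logarithm of the product of the inverse factors is a Riemann sum for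
      (1/t) int_0^oo ln ((x^4 + 3x^2/2 + 5/8 + 2al)/(x^4 + 3x^2/2)) dx.
    The integrand has an elementary primitive, and the integral is
    pi (2A - sqrt(3/2)), where A^2 = (3/4 + sqrt(5/8 + 2al))/2
    ([prod_gap_ratio_ge], [gap_primitive_ge]).

    Altogether, the norm of u is at least exp(m E) up to a constant, with E
    arbitrarily close to
      L (2A - sqrt(3/2)) - th L - |M| T (5/16 + al).
    Here th L m is the growth of exp(qx) on (0,L), which enters through the
    normalization of the datum: th = 1/2 for M > 0 and th = 0 for M < 0.  For
    M < 0 the choice al = 0 makes E positive when |M| T < 1.69 L, and for M > 0
    the choice al = 15/32, for which A = 1, makes it positive when MT < 0.33 L
    ([exponent_gap], [cost_exponential]). *)

(** * Partial fractions and Cauchy forms *)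

Section CauchySums.
Context {R : realFieldType}.

(** Induction on the number of factors.  A new factor (q - z)/(q + z) is split
    against each pole already present, and the accompanying constant
    (q - l 0)/(q + l 0) keeps the residue at - l 0 equal to 1. *)
Lemma partial_fractions (l : nat -> R) (n : nat) :
  (forall k, 0 < l k) -> injective l ->
  exists2 c : nat -> R, c 0%N = 1 &
    forall z, (forall k, z + l k != 0) ->
      \sum_(i < n.+1) c i / (z + l i)
      = (z + l 0%N)^-1 *
        \prod_(k < n) ((l k.+1 - l 0%N) / (l k.+1 + l 0%N)
                       * ((l k.+1 - z) / (l k.+1 + z))).
Proof.
move=> l_gt0 l_inj; elim: n => [|n [c c0 IHn]].
  exists (fun=> 1) => // z _.
  by rewrite big_ord_recl !big_ord0 addr0 mulr1 div1r.
pose q := l n.+1.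
pose b := (q - l 0%N) / (q + l 0%N).
(* the first case is the residue of the old pole - l i times the value of the new
   factor there; the second collects the residues at the new pole - q *)
pose c' i := if (i <= n)%N then b * c i * ((q + l i) / (q - l i))
             else - (b * \sum_(i < n.+1) c i * (2 * q / (q - l i))).
have sub_n0 i : (i <= n)%N -> q - l i != 0.
  by move=> le_in; rewrite subr_eq0; apply: contraTneq le_in => /l_inj <-; rewrite ltnn.
have add_n0 i : q + l i != 0 by rewrite lt0r_neq0 ?addr_gt0 ?l_gt0.
exists c'.
  rewrite /c' leq0n c0 /b; field.
  by rewrite sub_n0 ?add_n0. 
move=> z z_n0; rewrite big_ord_recr [in RHS]big_ord_recr/= -/q -/b.
have zq_n0 : z + q != 0 by exact: z_n0.
have qz_n0 : q + z != 0 by rewrite addrC.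
rewrite !(mulrA (z + l 0%N)^-1).
rewrite -IHn// /c' ltnn -?[l n.+1]/q.
under eq_bigr => i _ do rewrite leq_ord.
rewrite mulNr -mulrA mulr_suml mulr_sumr -sumrB mulr_suml; apply: eq_bigr => i _.
have := z_n0 i; have := sub_n0 i (leq_ord i); have := add_n0 0%N.
rewrite /b; move: (c i) (l i) (l 0%N) q zq_n0 qz_n0 {IHn b c' sub_n0 add_n0}.
move=> d p p0 q h1 h2 h3 h4 h5; field.
by rewrite ?h1 ?h2 ?h3 ?h4 ?h5.
Qed.

(** The partial fraction sum vanishes at every l i with i > 0, so that only the
    term i = 0 of the double sum survives.  As 1/(l i + l j) is the inner product
    of exp(- l i s) and exp(- l j s) on the half-line, this is the squared distance
    from the first of these exponentials to the span of the others. *)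
Lemma cauchy_form_extremal (l : nat -> R) (n : nat) :
  (forall k, 0 < l k) -> injective l ->
  exists2 c : nat -> R, c 0%N = 1 &
    \sum_(i < n.+1) \sum_(j < n.+1) c i * c j / (l i + l j)
    = (2 * l 0%N)^-1
      * (\prod_(k < n) ((l k.+1 - l 0%N) / (l k.+1 + l 0%N))) ^+ 2.
Proof.
move=> l_gt0 l_inj; have [c c0 cE] := partial_fractions _ n l_gt0 l_inj.
exists c => //.
transitivity (\sum_(i < n.+1) c i * ((l i + l 0%N)^-1 *
   \prod_(k < n) ((l k.+1 - l 0%N) / (l k.+1 + l 0%N)
                       * ((l k.+1 - l i) / (l k.+1 + l i))))).
  apply: eq_bigr => i _; rewrite -cE; last first.
    by move=> k; rewrite lt0r_neq0 ?addr_gt0 ?l_gt0.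
  by rewrite mulr_sumr; apply: eq_bigr => j _; rewrite mulrA.
rewrite big_ord_recl/= c0 mul1r [X in _ + X]big1 ?addr0.
  by congr (_^-1 * _); [ring | rewrite expr2 -big_split].
move=> i _; rewrite (bigD1 i)//= /bump/= add1n subrr mul0r mulr0 mul0r.
by rewrite !mulr0.
Qed.

End CauchySums.

(** * Square integrable functions *)

Section SquareIntegrable.
Local Open Scope classical_set_scope.
Context d (T : measurableType d) (R : realType) (mu : {measure set T -> \bar R}).
Implicit Types (D : set T) (f g : T -> R).

Lemma bounded_isL2 D f (K : R) : measurable D -> (mu D < +oo)%E ->
  measurable_fun D f -> (forall x, D x -> `|f x| <= K) -> isL2 mu D f.
Proof.
move=> mD muD mf fK.
have mfD : measurable_fun setT (f \_ D) by apply/(measurable_restrictT _ mD).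
rewrite /isL2 inE; apply/andP; split; rewrite inE//=.
rewrite /finite_norm unlock /Lnorm poweR_lty//.
apply: (@le_lt_trans _ _ (\int[mu]_x ((K ^+ 2)%:E * (\1_D x)%:E))%E).
  apply: ge0_le_integral => //=.
  - apply/measurable_EFinP/(measurableT_comp (measurable_powR _)).
    exact: measurableT_comp.
  - by apply/measurable_EFinP/measurable_funM => //; exact: measurable_indic.
  - move=> x _; rewrite lee_fin powR_mulrn// patchE indicE.
    case: ifPn => [xD|xD].
      rewrite mulr1 ler_sqr ?nnegrE// ?fK//; first by apply: set_mem.
      by apply: le_trans (fK x _); [|apply: set_mem].
    by rewrite normr0 expr0n/= mulr0.
rewrite ge0_integralZl_EFin ?sqr_ge0//; last first.
  by apply/measurable_EFinP; exact: measurable_indic.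
by rewrite integral_indic// setIT lte_mul_pinfty// lee_fin sqr_ge0.
Qed.

Lemma isL2_mul_integrable D f g : measurable D -> isL2 mu D f -> isL2 mu D g ->
  mu.-integrable D (EFin \o (f \* g)).
Proof.
move=> mD f2 g2; apply/integrable_mkcond => //.
have /Lfun1_integrable := Lfun2_mul_Lfun1 f2 g2.
apply: eq_integrable => // x _.
by rewrite /= !patchE; case: ifPn => // _; rewrite mulr0.
Qed.

Lemma isL2_integrable D f : measurable D -> (mu D < +oo)%E -> isL2 mu D f ->
  mu.-integrable D (EFin \o f).
Proof.
move=> mD muD f2; have g2 : isL2 mu D (cst 1).
  by apply: (bounded_isL2 _ _ 1) => // x _; rewrite normr1.
have := isL2_mul_integrable _ _ _ mD f2 g2.
by apply: eq_integrable => // x _ /=; rewrite mulr1.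
Qed.

Lemma Lnorm2_sqrt D f : measurable D -> isL2 mu D f ->
  ('N[mu]_(2%:E)[EFin \o (f \_ D)] = (Num.sqrt (\int[mu]_(x in D) (f x ^+ 2)))%:E)%E.
Proof.
move=> mD f2; have f2i := isL2_mul_integrable _ _ _ mD f2 f2.
rewrite unlock /Lnorm.
have -> : (\int[mu]_x `|(EFin \o f \_ D) x| `^ 2 = (\int[mu]_(x in D) (f x ^+ 2))%:E)%E.
  rewrite /Rintegral fineK; last exact: integrable_fin_num.
  rewrite [RHS]integral_mkcond; apply: eq_integral => x _ /=.
  rewrite powR_mulrn// !patchE; case: ifPn => // _; first by rewrite real_normK ?num_real.
  by rewrite normr0 expr0n.
by rewrite poweR_EFin powR12_sqrt// Rintegral_ge0// => x _; exact: sqr_ge0.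
Qed.

Lemma cauchy_schwarz D f g (B : R) : measurable D -> isL2 mu D f -> isL2 mu D g ->
  0 <= B -> \int[mu]_(x in D) (g x ^+ 2) <= B ^+ 2 ->
  (`|\int[mu]_(x in D) (f x * g x)|%:E <= 'N[mu]_(2%:E)[EFin \o (f \_ D)] * B%:E)%E.
Proof.
move=> mD f2 g2 B0 gB.
have fgi := isL2_mul_integrable _ _ _ mD f2 g2.
have := f2; have := g2; rewrite /isL2 !inE => /andP[+ _] /andP[+ _].
rewrite !inE/= => mg mf.
have := @hoelder _ _ _ mu (f \_ D) (g \_ D) 2 2 mf mg.
rewrite [_^-1 + _^-1](_ : _ = 1); last by rewrite [RHS]splitr !div1r.
move=> /(_ (ltr0Sn _ _) (ltr0Sn _ _) erefl).
rewrite Lnorm1; set I := (\int[mu]_x _)%E => IN.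
apply: (@le_trans _ _ I).
  rewrite EFin_normr_Rintegral//.
  apply: (le_trans (le_abse_integral _ mD _)); first exact: (measurable_int mu).
  rewrite le_eqVlt; apply/orP; left; apply/eqP.
  rewrite [LHS]integral_mkcond; apply: eq_integral => x _ /=.
  by rewrite !patchE; case: ifPn => // _; rewrite mulr0 normr0.
apply: (le_trans IN); apply: lee_wpmul2l; first exact: Lnorm_ge0.
by rewrite Lnorm2_sqrt// lee_fin -[leRHS]ger0_norm// -sqrtr_sqr ler_wsqrtr.
Qed.

Lemma Rintegral_sum D n (f : 'I_n -> T -> R) : measurable D ->
  (forall i, mu.-integrable D (EFin \o f i)) ->
  \int[mu]_(x in D) (\sum_(i < n) f i x) = \sum_(i < n) \int[mu]_(x in D) f i x.
Proof.
move=> mD fi; apply: EFin_inj; rewrite -sumEFin /Rintegral fineK; last first.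
  apply: integrable_fin_num => //.
  apply: (eq_integrable _ (fun x => \sum_(i < n) (f i x)%:E)%E) => //.
    by move=> x _; rewrite sumEFin.
  by apply: integrable_sum => // i _; exact: fi.
under eq_integral do rewrite -sumEFin.
rewrite integral_sum//; apply: eq_bigr => i _.
by rewrite fineK//; apply: integrable_fin_num => //; exact: fi.
Qed.

End SquareIntegrable.

(** * Calculus on the real line *)

Section Calculus.
Local Open Scope classical_set_scope.
Context {R : realType}.
Local Notation leb := (@lebesgue_measure R).
Implicit Types (f g F : R -> R) (a b k x : R).

(** The differentiation rules are stated for functions written with a bound
    variable, so that derivatives of explicit formulas are built by application. *)
Lemma is_derive_comp f g (df dg : R) x :
  is_derive (g x) 1 f df -> is_derive x 1 g dg ->
  is_derive x 1 (fun y => f (g y)) (dg * df).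
Proof.
move=> fE gE; have df' := @ex_derive _ _ _ _ _ _ _ fE.
have dg' := @ex_derive _ _ _ _ _ _ _ gE.
have /derivable1_diffP df1 := df'; have /derivable1_diffP dg1 := dg'.
apply: DeriveDef; first exact/derivable1_diffP/differentiable_comp.
rewrite -derive1E derive1_comp// !derive1E.
by rewrite (derive_val (f := f)) (derive_val (f := g)) mulrC.
Qed.

Lemma is_derive_cast f (df df' : R) x :
  is_derive x 1 f df -> df = df' -> is_derive x 1 f df'.
Proof. by move=> ? <-. Qed.

Lemma is_derive_add f g (df dg : R) x :
  is_derive x 1 f df -> is_derive x 1 g dg ->
  is_derive x 1 (fun y => f y + g y) (df + dg).
Proof. by move=> ? ?; exact: is_deriveD. Qed.

Lemma is_derive_sub f g (df dg : R) x :
  is_derive x 1 f df -> is_derive x 1 g dg ->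
  is_derive x 1 (fun y => f y - g y) (df - dg).
Proof. by move=> ? ?; exact: is_deriveB. Qed.

Lemma is_derive_mul f g (df dg : R) x :
  is_derive x 1 f df -> is_derive x 1 g dg ->
  is_derive x 1 (fun y => f y * g y) (f x * dg + g x * df).
Proof. by move=> ? ?; exact: is_deriveM. Qed.

Lemma is_derive_scale k f (df : R) x :
  is_derive x 1 f df -> is_derive x 1 (fun y => k * f y) (k * df).
Proof. by move=> ?; exact: is_deriveZ. Qed.

Lemma is_derive_bigsum n (h : 'I_n -> R -> R) (dh : 'I_n -> R) x :
  (forall i, is_derive x 1 (h i) (dh i)) ->
  is_derive x 1 (fun y => \sum_(i < n) h i y) (\sum_(i < n) dh i).
Proof.
move=> hE; rewrite (_ : (fun y => _) = \sum_(i < n) h i); first exact: is_derive_sum.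
by apply/funext => y; rewrite fct_sumE.
Qed.

Lemma is_derive_mull k x : is_derive x 1 (fun y => k * y) k.
Proof. by rewrite -{2}[k]mulr1; apply: is_derive_scale. Qed.

Lemma is_derive_mul_sub k c x : is_derive x 1 (fun y => k * (y - c)) k.
Proof.
rewrite -[X in is_derive _ _ _ X]mulr1; apply: is_derive_scale.
by rewrite -[X in is_derive _ _ _ X]subr0; apply: is_derive_sub.
Qed.

Lemma is_derive_exp_shift k c x :
  is_derive x 1 (fun y => expR (k * (y - c))) (k * expR (k * (x - c))).
Proof. by apply: is_derive_comp; exact: is_derive_mul_sub. Qed.

Lemma is_derive_sin_mull k x :
  is_derive x 1 (fun y => sin (k * y)) (k * cos (k * x)).
Proof. by apply: is_derive_comp; exact: is_derive_mull. Qed.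

Lemma is_derive_cos_mull k x :
  is_derive x 1 (fun y => cos (k * y)) (k * - sin (k * x)).
Proof. by apply: is_derive_comp; exact: is_derive_mull. Qed.

Lemma is_derive_continuous f (df : R -> R) :
  (forall x, is_derive x 1 f (df x)) -> continuous f.
Proof.
by move=> fE x; apply/differentiable_continuous/derivable1_diffP; exact: ex_derive.
Qed.

Lemma continuous_exp_shift k c : continuous (fun x => expR (k * (x - c))).
Proof. exact: is_derive_continuous (is_derive_exp_shift k c). Qed.

Lemma continuous_sin_mull k : continuous (fun x => sin (k * x)).
Proof. exact: is_derive_continuous (is_derive_sin_mull k). Qed.

Lemma continuous_itv_integrable a b f : continuous f ->
  leb.-integrable `[a, b] (EFin \o f).
Proof.
move=> cf; apply: continuous_compact_integrable; first exact: segment_compact.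
exact: continuous_subspaceT.
Qed.

Lemma integral_derivative a b F f : a <= b ->
  (forall x, is_derive x 1 F (f x)) -> continuous f ->
  \int[leb]_(x in `[a, b]) f x = F b - F a.
Proof.
rewrite le_eqVlt => /predU1P[<-|ab] FE cf.
  by rewrite set_itv1 Rintegral_set1 subrr.
have cF := is_derive_continuous _ _ FE.
rewrite /Rintegral (continuous_FTC2 (F := F))//.
- exact: continuous_subspaceT.
- split.
  + by move=> x _; exact: ex_derive.
  + exact/cvg_at_right_filter/cF.
  + exact/cvg_at_left_filter/cF.
- by move=> x _; rewrite derive1E derive_val.
Qed.

Lemma integral_itv_oo a b f : leb.-integrable `]a, b[ (EFin \o f) ->
  \int[leb]_(x in `]a, b[) f x = \int[leb]_(x in `[a, b]) f x.
Proof.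
move=> fi; congr fine; apply: esym; rewrite integral_itv_bndoo //.
exact: (measurable_int leb fi).
Qed.

Lemma integral_derivative_oo a b F f : a <= b ->
  (forall x, is_derive x 1 F (f x)) -> continuous f ->
  \int[leb]_(x in `]a, b[) f x = F b - F a.
Proof.
move=> ab FE cf; rewrite integral_itv_oo; first exact: (integral_derivative _ _ F).
by apply: integrableS (continuous_itv_integrable a b f cf) => //; exact: subset_itv_oo_cc.
Qed.

Lemma continuous_sqr f : continuous f -> continuous (fun s => f s ^+ 2).
Proof.
move=> cf s; apply: (@continuous_comp _ _ _ f (fun x => x ^+ 2)); first exact: cf.
exact: exprn_continuous.
Qed.

Lemma lebesgue_itv_oo_lty a b : (leb `]a, b[ < +oo)%E.
Proof. by rewrite lebesgue_measure_itv/=; case: ifP => // _; exact: ltry. Qed.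

End Calculus.

(** * The energy of exponential sums *)

Section ExponentialSums.
Local Open Scope classical_set_scope.
Context {R : realType}.
Local Notation leb := (@lebesgue_measure R).
Variables (n : nat) (l c : nat -> R).
Hypothesis l_gt0 : forall k, 0 < l k.

Definition expsum (T s : R) := \sum_(i < n.+1) c i * expR (l i * (s - T)).

(** This is the integral of the square of [expsum 0] over the half-line ending
    at [t]. *)
Definition tail_energy (t : R) := \sum_(i < n.+1) \sum_(j < n.+1)
  c i * c j / (l i + l j) * expR ((l i + l j) * t).

Lemma continuous_expsum (T : R) : continuous (expsum T).
Proof.
apply: (@is_derive_continuous _ _
  (fun s => \sum_(i < n.+1) c i * (l i * expR (l i * (s - T))))) => s.
apply: is_derive_bigsum => i; apply: is_derive_scale.
exact: is_derive_exp_shift.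
Qed.

Lemma is_derive_tail_energy (T s : R) :
  is_derive s 1 (fun r => tail_energy (r - T)) (expsum T s ^+ 2).
Proof.
rewrite (_ : expsum _ _ ^+ 2 = \sum_(i < n.+1) \sum_(j < n.+1)
   c i * c j / (l i + l j) * ((l i + l j) * expR ((l i + l j) * (s - T)))).
  apply: is_derive_bigsum => i; apply: is_derive_bigsum => j.
  by apply: is_derive_scale; exact: is_derive_exp_shift.
rewrite expr2 mulr_suml; apply: eq_bigr => i _; rewrite mulr_sumr.
apply: eq_bigr => j _; rewrite [(l i + l j) * (s - T)]mulrDl expRD.
by field; rewrite lt0r_neq0 ?addr_gt0.
Qed.

Lemma integral_expsum_sqr (a b T : R) : a <= b ->
  \int[leb]_(s in `]a, b[) (expsum T s) ^+ 2
  = tail_energy (b - T) - tail_energy (a - T).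
Proof.
move=> ab; apply: (integral_derivative_oo _ _ (fun s => tail_energy (s - T))) => //.
- exact: is_derive_tail_energy.
- exact/continuous_sqr/continuous_expsum.
Qed.

Lemma cvg_tail_energy_Ny : tail_energy (- x) @[x --> +oo] --> 0.
Proof.
have -> : 0 = \sum_(i < n.+1) \sum_(j < n.+1) c i * c j / (l i + l j) * 0.
  by rewrite big1 // => i _; rewrite big1 // => j _; rewrite mulr0.
apply: cvg_big; [exact: add_continuous|] => i _.
apply: cvg_big; [exact: add_continuous|] => j _; apply: cvgM; first exact: cvg_cst.
under eq_fun do rewrite mulrN.
apply: (@cvg_comp _ _ _ (fun x => (l i + l j) * x) (fun y => expR (- y))).
  by apply: gt0_cvgMry; [rewrite addr_gt0|exact: cvg_id].
exact: cvgr_expR.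
Qed.

(** The energy is nondecreasing, because its derivative is a square, and it
    vanishes at minus infinity. *)
Lemma tail_energy_ge0 (t : R) : 0 <= tail_energy t.
Proof.
apply: (cvgr_to_le cvg_tail_energy_Ny); near=> x.
have xt : - x <= t by rewrite lerNl; near: x; apply: nbhs_pinfty_ge; exact: num_real.
rewrite -subr_ge0 -[t]subr0 -[X in _ - tail_energy X]subr0 -integral_expsum_sqr//.
by apply: Rintegral_ge0 => s _; exact: sqr_ge0.
Unshelve. all: by end_near. Qed.

(** The Cauchy form is the squared norm of the sum on a whole half-line, so it
    bounds the squared norm on any finite interval. *)
Lemma integral_expsum_sqr_le (T : R) : 0 <= T ->
  \int[leb]_(s in `]0, T[) (expsum T s) ^+ 2
  <= \sum_(i < n.+1) \sum_(j < n.+1) c i * c j / (l i + l j).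
Proof.
move=> T0; rewrite integral_expsum_sqr// subrr.
apply: (@le_trans _ _ (tail_energy 0)); first by rewrite gerBl tail_energy_ge0.
rewrite le_eqVlt; apply/orP; left; apply/eqP; apply: eq_bigr => i _.
by apply: eq_bigr => j _; rewrite mulr0 expR0 mulr1.
Qed.

End ExponentialSums.

(** * Controls with vanishing moments *)

Section MomentBound.
Local Open Scope classical_set_scope.
Context {R : realType}.
Local Notation leb := (@lebesgue_measure R).

Lemma within_continuous_L2 (a b : R) (f : R -> R) :
  {within `[a, b], continuous f} -> L2 a b f.
Proof.
move=> cf.
have mf : measurable_fun `[a, b] f by exact: subspace_continuous_measurable_fun.
have [K [_ fK]] : bounded_set (f @` `[a, b]).
  by apply: compact_bounded; apply: continuous_compact => //; exact: segment_compact.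
apply: (@bounded_isL2 _ _ _ _ _ _ (K + 1)) => //.
- exact: lebesgue_itv_oo_lty.
- by apply: measurable_funS mf => //; exact: subset_itv_oo_cc.
- move=> x /subset_itv_oo_cc xab.
  by apply: (fK (K + 1)); [rewrite ltrDl|exists x].
Qed.

Lemma continuous_L2 (a b : R) (f : R -> R) : continuous f -> L2 a b f.
Proof. by move=> cf; apply/within_continuous_L2/continuous_subspaceT. Qed.

Lemma L2_integrable (a b : R) (f : R -> R) : L2 a b f ->
  leb.-integrable `]a, b[ (EFin \o f).
Proof. by apply: isL2_integrable => //; exact: lebesgue_itv_oo_lty. Qed.

Lemma L2_mul_integrable (a b : R) (f g : R -> R) : L2 a b f -> L2 a b g ->
  leb.-integrable `]a, b[ (EFin \o (fun x => f x * g x)).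
Proof. by move=> f2 g2; apply: isL2_mul_integrable. Qed.

(** Cauchy-Schwarz against the sum of the exp(m i (s - T)) whose coefficients are
    extremal for the shifted rates m i + a: the pairing with u only sees the first
    moment.  On (0,T) that sum is exp(a (T - s)) times the shifted one, so its norm
    is at most exp(aT) times the norm of the shifted sum on a half-line. *)
Lemma moment_bound (T a : R) (m : nat -> R) (n : nat) (u : R -> R) :
  0 < T -> 0 <= a -> 0 < m 0%N -> {homo m : i j / (i < j)%N >-> i < j} ->
  L2 0 T u ->
  (forall k, (k < n)%N ->
     \int[leb]_(s in `]0, T[) (u s * expR (m k.+1 * (s - T))) = 0) ->
  ((`|\int[leb]_(s in `]0, T[) (u s * expR (m 0%N * (s - T)))|
    * Num.sqrt (2 * (m 0%N + a))
    * \prod_(k < n) ((m k.+1 + m 0%N + 2 * a) / (m k.+1 - m 0%N)))%:E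
   <= L2norm 0 T u * (expR (a * T))%:E)%E.
Proof.
move=> T0 a0 m0 m_incr u2 u_mom.
have m_gt0 k : 0 < m k by case: k => // k; apply: lt_trans m0 _; exact: m_incr.
pose l k := m k + a.
have l_gt0 k : 0 < l k by rewrite ltr_pwDl.
have l_inj : injective l.
  move=> i j /addIr mij; case: (ltngtP i j) => // /m_incr; by rewrite mij ltxx.
have [c c0 cE] := cauchy_form_extremal l n l_gt0 l_inj.
pose g := expsum n m c T.
have cg : continuous g by exact: continuous_expsum.
have mT : measurable (`]0, T[ : set R) by [].
have ug : \int[leb]_(s in `]0, T[) (u s * g s)
          = \int[leb]_(s in `]0, T[) (u s * expR (m 0%N * (s - T))).
  have ui k : leb.-integrable `]0, T[ (EFin \o (fun s => u s * expR (m k * (s - T)))).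
    apply: L2_mul_integrable => //.
    exact: continuous_L2 (continuous_exp_shift _ _).
  under eq_Rintegral => s _ do rewrite /g /expsum mulr_sumr.
  rewrite Rintegral_sum//; last first.
    move=> i; refine (@eq_integrable _ _ _ leb _ mT
      (fun s => (c i)%:E * (u s * expR (m i * (s - T)))%:E)%E _ _ _).
      by move=> s _; rewrite -EFinM mulrCA.
    exact/integrableZl/ui.
  transitivity (\sum_(i < n.+1)
      c i * \int[leb]_(s in `]0, T[) (u s * expR (m i * (s - T)))).
    apply: eq_bigr => i _; rewrite -RintegralZl//.
    by apply: eq_Rintegral => s _; rewrite mulrCA.
  rewrite big_ord_recl/= c0 mul1r [X in _ + X]big1 ?addr0// => i _.
  by rewrite u_mom ?mulr0.
pose P := \prod_(k < n) ((l k.+1 - l 0%N) / (l k.+1 + l 0%N)).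
have P0 : 0 < P.
  apply: prodr_gt0 => k _; apply: divr_gt0; last exact: addr_gt0.
  by rewrite subr_gt0 ltrD2r; exact: m_incr.
pose B := expR (a * T) * (P / Num.sqrt (2 * l 0%N)).
have B0 : 0 <= B by rewrite mulr_ge0 ?expR_ge0 ?divr_ge0 ?sqrtr_ge0// ltW.
have gB : \int[leb]_(s in `]0, T[) (g s ^+ 2) <= B ^+ 2.
  have -> : B ^+ 2 = expR (a * T) ^+ 2 *
     \sum_(i < n.+1) \sum_(j < n.+1) c i * c j / (l i + l j).
    rewrite cE /B -/P !exprMn exprVn sqr_sqrtr; last by rewrite mulr_ge0// ltW.
    by rewrite [P ^+ 2 * _]mulrC.
  apply: le_trans (ler_wpM2l (sqr_ge0 _) (integral_expsum_sqr_le n l c l_gt0 T (ltW T0))).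
  have ch : continuous (fun s : R => expsum n l c T s ^+ 2).
    exact/continuous_sqr/continuous_expsum.
  have iT f : continuous f -> leb.-integrable `]0, T[ (EFin \o f).
    move=> cf; apply: integrableS (continuous_itv_integrable 0 T f cf) => //.
    exact: subset_itv_oo_cc.
  rewrite -RintegralZl//; last exact: iT.
  apply: le_Rintegral => //.
  - exact/iT/continuous_sqr.
  - by apply: iT => s; apply: cvgM; [exact: cvg_cst|exact: ch].
  - move=> s /=; rewrite in_itv/= => /andP[s0 sT].
    have -> : g s = expR (a * (T - s)) * expsum n l c T s.
      rewrite /g /expsum mulr_sumr; apply: eq_bigr => i _.
      by rewrite mulrCA -expRD; congr (_ * expR _); rewrite /l; ring.
    rewrite exprMn ler_wpM2r ?sqr_ge0// ler_sqr ?nnegrE ?expR_ge0// ler_expR.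
    by rewrite ler_wpM2l// gerBl ltW.
have := cauchy_schwarz _ _ _ leb _ u g B mT u2 (continuous_L2 _ _ _ cg) B0 gB.
rewrite ug -/(L2norm 0 T u); set I := `|_|%R => IB.
rewrite (_ : \prod_(k < n) _ = P^-1); last first.
  rewrite -prodfV; apply: eq_bigr => k _; rewrite invf_div.
  by congr (_ / _); rewrite /l; ring.
rewrite -/(l 0%N); set q := Num.sqrt _ in B B0 gB IB *.
have q0 : 0 < q by rewrite sqrtr_gt0 mulr_gt0.
rewrite -mulrA EFinM.
apply: (le_trans (lee_wpmul2r _ IB)); first by rewrite lee_fin mulr_ge0 ?invr_ge0// ltW.
rewrite -muleA -EFinM /B.
by rewrite (_ : _ * (q / P) = expR (a * T))//; field; rewrite !lt0r_neq0.
Qed.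

End MomentBound.

(** * Integration by parts for absolutely continuous functions *)

Section ByParts.
Local Open Scope classical_set_scope.
Context {R : realType}.
Local Notation leb := (@lebesgue_measure R).

Lemma integral_fin d (T : measurableType d) (mu : {measure set T -> \bar R})
    (D : set T) (f : T -> R) : measurable D -> mu.-integrable D (EFin \o f) ->
  (\int[mu]_(x in D) (f x)%:E)%E = (\int[mu]_(x in D) f x)%:E.
Proof. by move=> mD fi; rewrite /Rintegral fineK//; exact: integrable_fin_num. Qed.

Lemma integrable_tensor d1 d2 (T1 : measurableType d1) (T2 : measurableType d2)
    (mu1 : {sigma_finite_measure set T1 -> \bar R})
    (mu2 : {sigma_finite_measure set T2 -> \bar R}) (f : T1 -> R) (g : T2 -> R) :
  mu1.-integrable setT (EFin \o f) -> mu2.-integrable setT (EFin \o g) ->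
  (mu1 \x mu2)%E.-integrable setT (fun z => (f z.1 * g z.2)%:E).
Proof.
move=> fi gi.
have mf : measurable_fun setT f by exact/measurable_EFinP/(measurable_int mu1 fi).
have mg : measurable_fun setT g by exact/measurable_EFinP/(measurable_int mu2 gi).
apply/integrable12ltyP.
  apply/measurable_EFinP; apply: measurable_funM.
    exact: (measurableT_comp mf measurable_fst).
  exact: (measurableT_comp mg measurable_snd).
have /integrableP[_ foo] := fi; have /integrableP[_ goo] := gi.
under eq_integral => x _.
  under eq_integral => y _ do rewrite /= normrM EFinM.
  rewrite ge0_integralZl_EFin//; last exact/measurable_EFinP/measurableT_comp.
  over.
rewrite /= ge0_integralZr//=.
- by rewrite lte_mul_pinfty ?integral_ge0// ge0_fin_numE// integral_ge0.
- exact/measurable_EFinP/measurableT_comp.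
- exact: integral_ge0.
Qed.

(** Fubini for f1 r * g1 x on the triangle 0 <= x <= r <= L, which only asks that
    g1 be integrable. *)
Lemma integral_triangle_swap (L : R) (g1 f f1 : R -> R) : 0 <= L ->
  leb.-integrable `[0, L] (EFin \o g1) ->
  (forall x : R, is_derive x 1 f (f1 x)) -> continuous f1 ->
  \int[leb]_(x in `[0, L]) (g1 x * (f L - f x))
  = \int[leb]_(r in `[0, L]) (f1 r * \int[leb]_(x in `[0, r]) g1 x).
Proof.
move=> L0 g1i fE cf1.
set D : set (measurableTypeR R) := `[0, L]%classic.
have mD : measurable D by exact: measurable_itv.
pose a : measurableTypeR R -> measurableTypeR R := g1 \_ D.
pose b : measurableTypeR R -> measurableTypeR R := f1 \_ D.
have ai : leb.-integrable setT (EFin \o a).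
  by rewrite /a -restrict_EFin; exact/(integrable_mkcond _ mD).
have f1i c d : leb.-integrable `[c, d] (EFin \o f1) by exact: continuous_itv_integrable.
have bi : leb.-integrable setT (EFin \o b).
  by rewrite /b -restrict_EFin; apply/(integrable_mkcond _ mD); exact: f1i.
have ma : measurable_fun setT a.
  by have := measurable_int leb ai => ?; exact/measurable_EFinP.
have mb : measurable_fun setT b.
  by have := measurable_int leb bi => ?; exact/measurable_EFinP.
pose F (z : measurableTypeR R * measurableTypeR R) : \bar R :=
  (if z.1 <= z.2 then a z.1 * b z.2 else 0)%:E.
have abi := integrable_tensor _ _ _ _ leb leb a b ai bi.
have Fi : (leb \x leb)%E.-integrable setT F.
  apply: le_integrable abi => //.
    apply/measurable_EFinP; apply: measurable_fun_ifT => //.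
    - by apply: measurable_fun_ler; [exact: measurable_fst|exact: measurable_snd].
    - apply: measurable_funM.
        exact: (measurableT_comp ma measurable_fst).
      exact: (measurableT_comp mb measurable_snd).
  by move=> z _; rewrite /F lee_fin; case: ifP => // _; rewrite normr0.
have innerl x : x \in D ->
    (\int[leb]_y F (x, y) = (g1 x * (f L - f x))%:E)%E.
  rewrite inE /D/= in_itv/= => /andP[x0 xL].
  rewrite -(integral_derivative _ _ f f1 xL fE cf1) EFinM -integral_fin//.
  rewrite -integralZl// [RHS]integral_mkcond; apply: eq_integral => y _.
  rewrite /F/= /a /b !patchE !mem_setE /D !in_itv/= x0 xL/=.
  by case: (leP x y) => //= xy; rewrite (le_trans x0 xy)/=; case: ifP; rewrite ?mulr0.
have innerr r : r \in D ->
    (\int[leb]_x F (x, r) = (f1 r * \int[leb]_(x in `[0%R, r]) g1 x)%:E)%E.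
  rewrite inE /D/= in_itv/= => /andP[r0 rL].
  have g1r : leb.-integrable `[0, r] (EFin \o g1).
    by apply: integrableS g1i => //; apply: subset_itvl; rewrite bnd_simp.
  rewrite EFinM -integral_fin//.
  rewrite -integralZl// [RHS]integral_mkcond; apply: eq_integral => x _.
  rewrite /F/= /a /b !patchE !mem_setE /D !in_itv/= r0 rL/=.
  case: (leP x r) => /= xr; last by rewrite andbF.
  by rewrite andbT (le_trans xr rL) andbT; case: ifP; rewrite ?mul0r// mulrC.
have outer (x : R) : x \notin D -> a x = 0 /\ b x = 0.
  by move=> xD; rewrite /a /b !patchE (negbTE xD).
rewrite /Rintegral; congr fine.
transitivity (\int[leb]_x \int[leb]_y F (x, y))%E.
  rewrite integral_mkcond; apply: eq_integral => x _; rewrite patchE.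
  case: ifPn => [/innerl <-//|xD].
  rewrite /F integral0_eq// => y _ /=.
  by case: ifP => // _; rewrite (outer x xD).1 mul0r.
rewrite (Fubini Fi).
rewrite [RHS]integral_mkcond; apply: eq_integral => r _; rewrite patchE.
case: ifPn => [/innerr <-//|rD].
rewrite /F integral0_eq// => x _ /=.
by case: ifP => // _; rewrite (outer r rD).2 mulr0.
Qed.

Lemma integrable_itv_cc (a b : R) (f : R -> R) :
  leb.-integrable `]a, b[ (EFin \o f) -> leb.-integrable `[a, b] (EFin \o f).
Proof.
move=> /integrableP[mf foo]; apply/integrableP; split.
  apply/measurable_EFinP; apply: (@measurable_fun_itv_cc _ a b false true).
  exact/measurable_EFinP.
by rewrite integral_itv_bndoo//; exact: measurableT_comp.
Qed.

Lemma isH1_L2 (L : R) (g g1 : R -> R) : 0 <= L -> isH1 L g g1 -> L2 0 L g.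
Proof.
move=> L0 [g12 gE].
pose G x := g 0 + \int[leb]_(r in `[0, x]) g1 r.
have G2 : L2 0 L G.
  apply: within_continuous_L2 => x; apply: cvgD; first exact: cvg_cst.
  apply: parameterized_integral_continuous => //.
  exact/integrable_itv_cc/L2_integrable.
rewrite /L2 /isL2 (_ : g \_ _ = G \_ `]0, L[)//.
apply/funext => x; rewrite !patchE.
by case: ifPn => // /set_mem/subset_itv_oo_cc/gE ->.
Qed.

(** As g1 is only square integrable, g need not be differentiable everywhere and
    the product rule does not apply.  Instead g and f are both written as
    integrals of their derivatives and the order of integration is exchanged. *)
Lemma isH1_by_parts (L : R) (g g1 f f1 : R -> R) : 0 <= L -> isH1 L g g1 ->
  (forall x : R, is_derive x 1 f (f1 x)) -> continuous f1 ->
  \int[leb]_(x in `]0, L[) (f x * g1 x)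
  = f L * g L - f 0 * g 0 - \int[leb]_(x in `]0, L[) (f1 x * g x).
Proof.
move=> L0 gH fE cf1; have [g12 gE] := gH.
have g2 := isH1_L2 _ _ _ L0 gH.
have cf : continuous f by exact: is_derive_continuous fE.
have g1i := L2_integrable _ _ _ g12.
have oocc (h k : R -> R) : continuous h -> L2 0 L k ->
    leb.-integrable `]0, L[ (EFin \o (h \* k)).
  by move=> ch k2; apply: L2_mul_integrable => //; exact: continuous_L2.
have mcc : measurable (`[0, L] : set R) by [].
have gL : \int[leb]_(x in `[0, L]) g1 x = g L - g 0.
  by rewrite (gE L) ?in_itv/= ?L0 ?lexx// addrC addKr.
have := integral_triangle_swap L g1 f f1 L0 (integrable_itv_cc _ _ _ g1i) fE cf1.
rewrite (@eq_Rintegral _ _ _ leb _ (fun x => f L * g1 x - f x * g1 x)); last first.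
  by move=> x _; rewrite mulrC mulrBl.
rewrite [RHS](@eq_Rintegral _ _ _ leb _ (fun x => f1 x * g x - g 0 * f1 x)); last first.
  move=> x; rewrite inE/= => xL.
  by rewrite (gE x xL) mulrDr [g 0 * _]mulrC addrAC subrr add0r.
have c1 : continuous (fun _ : R => f L) by move=> x; exact: cvg_cst.
rewrite RintegralB//; last 2 first.
- exact/integrable_itv_cc/((oocc (fun=> f L))).
- exact/integrable_itv_cc/oocc.
rewrite RintegralZl//; last exact: integrable_itv_cc.
rewrite RintegralB//; last 2 first.
- exact/integrable_itv_cc/oocc.
- by apply: continuous_itv_integrable => x; apply: cvgM; [exact: cvg_cst|exact: cf1].
rewrite RintegralZl//; last exact: continuous_itv_integrable.
rewrite gL (integral_derivative _ _ f f1 L0 fE cf1).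
rewrite -!integral_itv_oo; try exact: oocc.
move=> H; lra.
Qed.

End ByParts.

(** * Separated solutions of the adjoint system *)

Section Modes.
Local Open Scope classical_set_scope.
Context {R : realType}.
Local Notation leb := (@lebesgue_measure R).

Lemma smooth_isH1 (L : R) (f f1 : R -> R) :
  (forall x : R, is_derive x 1 f (f1 x)) -> continuous f1 -> isH1 L f f1.
Proof.
move=> fE cf1; split; first exact: continuous_L2.
move=> x; rewrite in_itv/= => /andP[x0 _].
by rewrite (integral_derivative _ _ f f1 x0 fE cf1) addrC subrK.
Qed.

Lemma continuous_scale (k : R) (f : R -> R) : continuous f ->
  continuous (fun x => k * f x).
Proof. by move=> cf x; apply: cvgM; [exact: cvg_cst|exact: cf]. Qed.

Lemma tensor_isL2_rect (t L : R) (e w : R -> R) : 0 <= t -> 0 <= L ->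
  continuous e -> continuous w -> isL2_rect t L (fun s x => e s * w x).
Proof.
move=> t0 L0 ce cw.
have bounded_itv (f : R -> R) (b : R) : 0 <= b -> continuous f ->
    exists2 K : R, 0 <= K & forall x : R, 0 < x < b -> `|f x| <= K.
  move=> b0 cf; have cnf : {within `[0, b], continuous (fun x => `|f x|)}.
    apply: continuous_subspaceT => x.
    apply: (@continuous_comp _ _ _ f (fun y : R => `|y|)); first exact: cf.
    exact: norm_continuous.
  have [c cb fc] := EVT_max b0 cnf; exists `|f c| => // x /andP[x0 xb].
  by apply: fc; rewrite in_itv/= !ltW.
have [K K0 eK] := bounded_itv e t t0 ce; have [K' K'0 wK'] := bounded_itv w L L0 cw.
apply: (@bounded_isL2 _ _ _ _ _ _ (K * K')).
- by apply: measurableX.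
- rewrite [X in (X < _)%E](_ : _ = leb `]0%R, t[%classic * leb `]0%R, L[%classic)%E;
    last exact: product_measure1E.
  by rewrite lte_mul_pinfty ?lebesgue_itv_oo_lty// ge0_fin_numE ?lebesgue_itv_oo_lty.
- apply: measurable_funTS; apply: measurable_funM.
    apply: (measurableT_comp (f := e)); last exact: measurable_fst.
    exact: continuous_measurable_fun.
  apply: (measurableT_comp (f := w)); last exact: measurable_snd.
  exact: continuous_measurable_fun.
- move=> [x y] [/=]; rewrite !in_itv/= => xt yL.
  by rewrite normrM ler_pM ?eK ?wK'.
Qed.

(** Here w is an eigenfunction of B^* with eigenvalue lam; then eps w_xxxx -
    delta w_xxx - M w_x is (lam w)_xx - (delta/2) w_xxx - M w_x, and [w_mu] says
    that w is an eigenfunction of the adjoint operator, with eigenvalue mu. *)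
Section Mode.
Variables (eps L M t lam mu : R) (w w1 w2 w3 : R -> R).
Hypotheses (t0 : 0 <= t) (L0 : 0 <= L).
Hypotheses (wE : forall x : R, is_derive x 1 w (w1 x))
  (w1E : forall x : R, is_derive x 1 w1 (w2 x))
  (w2E : forall x : R, is_derive x 1 w2 (w3 x)) (cw3 : continuous w3).
Hypotheses (w_0 : w 0 = 0) (w_L : w L = 0).
Hypothesis w_B : forall x, eps * w2 x - delta eps M / 2%:R * w1 x = lam * w x.
Hypothesis w_mu : forall x,
  lam * w2 x - delta eps M / 2%:R * w3 x - M * w1 x = mu * w x.

Let cw : continuous w. Proof. exact: is_derive_continuous wE. Qed.
Let cw1 : continuous w1. Proof. exact: is_derive_continuous w1E. Qed.
Let cw2 : continuous w2. Proof. exact: is_derive_continuous w2E. Qed.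

Let e (s : R) := expR (mu * (s - t)).

Let is_derive_e (s : R) : is_derive s 1 e (mu * e s).
Proof. exact: is_derive_exp_shift. Qed.

Let ce : continuous e. Proof. exact: continuous_exp_shift. Qed.

Lemma mode_isH2H10 (k : R) :
  isH2H10 L (fun x => k * w x) (fun x => k * w1 x) (fun x => k * w2 x).
Proof.
split; rewrite ?w_0 ?w_L ?mulr0//.
- by apply: smooth_isH1; exact: continuous_scale.
- by apply: smooth_isH1; exact: continuous_scale.
Qed.

(** All derivatives are moved from psi to w.  The boundary terms vanish because psi
    does, and because the coefficient B^* w = lam w of psi_xx does. *)
Lemma mode_form (k : R) (psi psi1 psi2 : R -> R) : isH2H10 L psi psi1 psi2 ->
  adjoint_form eps L M (fun x => k * w1 x) (fun x => k * w2 x) psi psi1 psi2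
  = k * (mu * \int[leb]_(x in `]0, L[) (w x * psi x)).
Proof.
move=> [H1psi H1psi1 psi0 psiL].
have psi_2 := isH1_L2 _ _ _ L0 H1psi; have [psi1_2 _] := H1psi.
have [psi2_2 _] := H1psi1.
have ii (h g : R -> R) : continuous h -> L2 0 L g ->
    leb.-integrable `]0, L[ (EFin \o (fun x => h x * g x)).
  by move=> ch g2; apply: L2_mul_integrable => //; exact: continuous_L2.
have iik (h g : R -> R) c : continuous h -> L2 0 L g ->
    leb.-integrable `]0, L[ (EFin \o (fun x => c * (h x * g x))).
  move=> ch g2.
  apply: (@eq_integrable _ _ _ leb _ _ (EFin \o (fun x => (c * h x) * g x))) => //.
    by move=> x _ /=; rewrite mulrA.
  by apply: ii => //; exact: continuous_scale.
pose d := delta eps M / 2%:R.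
have wB x : eps * w2 x - d * w1 x = lam * w x by exact: w_B.
have wmu x : lam * w2 x - d * w3 x - M * w1 x = mu * w x by exact: w_mu.
transitivity (k * lam * (\int[leb]_(x in `]0, L[) (w x * psi2 x))
    + k * d * (\int[leb]_(x in `]0, L[) (w2 x * psi1 x))
    - k * M * \int[leb]_(x in `]0, L[) (w1 x * psi x)).
  rewrite /adjoint_form (@eq_Rintegral _ _ _ leb _ (fun x => k * lam * (w x * psi2 x)
    + k * d * (w2 x * psi1 x) - k * M * (w1 x * psi x))); last first.
    move=> x _; rewrite -/d.
    by rewrite (_ : k * lam * _ = k * (lam * w x) * psi2 x); [rewrite -wB|]; ring.
  rewrite RintegralB//; last 2 first.
  - exact: (integrableD _ (iik w psi2 (k * lam) cw psi2_2) (iik w2 psi1 (k * d) cw2 psi1_2)).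
  - exact: iik.
  rewrite RintegralD//; try exact: iik.
  by rewrite !RintegralZl//; exact: ii.
rewrite (isH1_by_parts L psi1 psi2 w w1)// (isH1_by_parts L psi psi1 w1 w2)//.
rewrite (isH1_by_parts L psi psi1 w2 w3)// w_0 w_L psi0 psiL !mulr0 !mul0r !subr0 !sub0r opprK.
have -> : mu * \int[leb]_(x in `]0, L[) (w x * psi x) =
    lam * (\int[leb]_(x in `]0, L[) (w2 x * psi x))
    - d * (\int[leb]_(x in `]0, L[) (w3 x * psi x))
    - M * (\int[leb]_(x in `]0, L[) (w1 x * psi x)).
  rewrite -!RintegralZl//; try exact: ii.
  rewrite -!RintegralB//; try exact: iik.
    by apply: eq_Rintegral => x _; rewrite mulrA -wmu; ring.
  exact: (integrableB _ (iik w2 psi lam cw2 psi_2) (iik w3 psi d cw3 psi_2)).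
ring.
Qed.

Lemma mode_adjoint_solution :
  adjoint_solution eps L M t w (fun s x => expR (mu * (s - t)) * w x)
    (fun s x => expR (mu * (s - t)) * w1 x) (fun s x => expR (mu * (s - t)) * w2 x).
Proof.
change (adjoint_solution eps L M t w (fun s x => e s * w x)
  (fun s x => e s * w1 x) (fun s x => e s * w2 x)).
have et : e t = 1 by rewrite /e subrr mulr0 expR0.
split.
- by move=> s _; apply/continuous_L2/continuous_scale.
- move=> s _.
  have -> : (fun r => L2norm 0 L ((fun x => e r * w x) \- (fun x => e s * w x)))
     = (fun r => (`|e r - e s| * Num.sqrt (\int[leb]_(x in `]0, L[) (w x ^+ 2)))%:E).
    apply/funext => r; rewrite /L2norm Lnorm2_sqrt//; last first.
      by apply: continuous_L2 => x; apply: cvgB; exact: continuous_scale.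
    congr EFin; rewrite -sqrtr_sqr -sqrtrM ?sqr_ge0//; congr (Num.sqrt _).
    rewrite -RintegralZl//.
      by apply: eq_Rintegral => x _ /=; rewrite -mulrBl exprMn.
    exact: (L2_mul_integrable 0 L w w (continuous_L2 _ _ _ cw) (continuous_L2 _ _ _ cw)).
  apply: cvg_EFin; first by apply: nearW.
  rewrite [X in _ --> X](_ : _ =
    `|e s - e s| * Num.sqrt (\int[leb]_(x in `]0, L[) (w x ^+ 2))); last first.
    by rewrite subrr normr0 mul0r.
  apply: cvg_within_filter.
  apply: cvgM; last exact: cvg_cst.
  by apply: cvg_norm; apply: cvgB; [exact: ce|exact: cvg_cst].
- by apply: aeW => s _; exact: mode_isH2H10.
- by split; exact: tensor_isL2_rect.
- by apply: aeW => x _; rewrite et mul1r.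
- move=> psi psi1 psi2 Hpsi s; rewrite in_itv/= => /andP[s0 st].
  set J := \int[leb]_(x in `]0, L[) (w x * psi x).
  have JE k : \int[leb]_(x in `]0, L[) (k * w x * psi x) = k * J.
    rewrite -RintegralZl//; first by apply: eq_Rintegral => x _; rewrite mulrA.
    have psi_2 : L2 0 L psi by case: Hpsi => + _ _ _; exact: isH1_L2.
    exact: (L2_mul_integrable 0 L w psi (continuous_L2 _ _ _ cw) psi_2).
  rewrite !JE (@eq_Rintegral _ _ _ leb _ (fun r => J * (mu * e r))); last first.
    by move=> r _; rewrite mode_form// -/J; ring.
  rewrite RintegralZl//; last exact/continuous_itv_integrable/continuous_scale.
  rewrite (integral_derivative _ _ e _ st is_derive_e); last exact: continuous_scale.
  by rewrite mulrBr [J * _]mulrC [J * e s]mulrC.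
Qed.

End Mode.
End Modes.

(** * Explicit modes and the moment problem *)

Section SineModes.
Local Open Scope classical_set_scope.
Context {R : realType}.
Local Notation leb := (@lebesgue_measure R).

(** A family that is stable under differentiation and contains the adjoint modes,
    which are the functions [damped q k 1 0]. *)
Definition damped (q k A B x : R) :=
  expR (- q * x) * (A * sin (k * x) + B * cos (k * x)).

Lemma is_derive_damped (q k A B x : R) :
  is_derive x 1 (damped q k A B)
    (damped q k (- q * A - k * B) (k * A - q * B) x).
Proof.
have e' : is_derive x 1 (fun y => expR (- q * y)) (- q * expR (- q * x)).
  by apply: is_derive_comp; exact: is_derive_mull.
have sc' := is_derive_add _ _ _ _ _ (is_derive_scale A _ _ _ (is_derive_sin_mull k x))
  (is_derive_scale B _ _ _ (is_derive_cos_mull k x)).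
apply: (is_derive_cast _ _ _ _ (is_derive_mul _ _ _ _ _ e' sc')).
by rewrite /damped; ring.
Qed.

Lemma continuous_damped (q k A B : R) : continuous (damped q k A B).
Proof. exact: is_derive_continuous (is_derive_damped q k A B). Qed.

Lemma sin_natmul_pi (n : nat) : sin (n%:R * pi) = 0 :> R.
Proof.
elim: n => [|n IHn]; first by rewrite mul0r sin0.
by rewrite -natr1 mulrDl mul1r sinDpi IHn oppr0.
Qed.

(** The primitive is the Wronskian of the two sines divided by a^2 - b^2. *)
Lemma integral_sin_sin (L a b : R) : 0 <= L -> a ^+ 2 != b ^+ 2 ->
  sin (a * L) = 0 -> sin (b * L) = 0 ->
  \int[leb]_(x in `]0, L[) (sin (a * x) * sin (b * x)) = 0.
Proof.
move=> L0 ab aL bL.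
pose F x := (a ^+ 2 - b ^+ 2)^-1
  * (b * (sin (a * x) * cos (b * x)) - a * (cos (a * x) * sin (b * x))).
have FE (x : R) : is_derive x 1 F (sin (a * x) * sin (b * x)).
  apply: (is_derive_cast _ _ _ _ (is_derive_scale _ _ _ _ (is_derive_sub _ _ _ _ _
    (is_derive_scale b _ _ _ (is_derive_mul _ _ _ _ _
      (is_derive_sin_mull a x) (is_derive_cos_mull b x)))
    (is_derive_scale a _ _ _ (is_derive_mul _ _ _ _ _
      (is_derive_cos_mull a x) (is_derive_sin_mull b x)))))).
  by field; rewrite subr_eq0.
rewrite (integral_derivative_oo _ _ _ _ L0 FE).
  rewrite /F aL bL !mulr0 sin0; ring.
by move=> x; apply: cvgM; exact: continuous_sin_mull.
Qed.

Lemma integral_sin_sqr (L a : R) : 0 <= L -> a != 0 -> sin (a * L) = 0 ->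
  \int[leb]_(x in `]0, L[) (sin (a * x) * sin (a * x)) = L / 2.
Proof.
move=> L0 a0 aL.
pose F (x : R) := 2^-1 * x - (2 * a)^-1 * (sin (a * x) * cos (a * x)).
have FE (x : R) : is_derive x 1 F (sin (a * x) * sin (a * x)).
  apply: (is_derive_cast _ _ _ _ (is_derive_sub _ _ _ _ _ (is_derive_mull _ x)
    (is_derive_scale _ _ _ _ (is_derive_mul _ _ _ _ _
      (is_derive_sin_mull a x) (is_derive_cos_mull a x))))).
  have -> : 2^-1 = (cos (a * x) ^+ 2 + sin (a * x) ^+ 2) / 2 :> R.
    by rewrite cos2Dsin2 div1r.
  by field.
rewrite (integral_derivative_oo _ _ _ _ L0 FE).
  rewrite /F aL !mulr0 sin0; ring.
by move=> x; apply: cvgM; exact: continuous_sin_mull.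
Qed.

Section NullControl.
Variables (eps T L M q : R).
Hypotheses (eps0 : 0 < eps) (T0 : 0 < T) (L0 : 0 < L).
Hypotheses (q_delta : delta eps M = - (4 * eps * q)) (q_M : M = 8 * eps * q ^+ 3).

(** The eigenvalue of eps d^4 - delta d^3 - M d on the mode of wavenumber k, for
    delta = -4 eps q and M = 8 eps q^3. *)
Definition mode_rate (k : R) := eps * ((k ^+ 2 + q ^+ 2) * (k ^+ 2 + 5 * q ^+ 2)).

Lemma sine_adjoint_solution (k : R) : sin (k * L) = 0 ->
  adjoint_solution eps L M T (damped q k 1 0)
    (fun s x => expR (mode_rate k * (s - T)) * damped q k 1 0 x)
    (fun s x => expR (mode_rate k * (s - T)) * damped q k (- q) k x)
    (fun s x => expR (mode_rate k * (s - T))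
                * damped q k (q ^+ 2 - k ^+ 2) (- (2 * q * k)) x).
Proof.
move=> kL.
have w0E (x : R) : is_derive x 1 (damped q k 1 0) (damped q k (- q) k x).
  apply: (is_derive_cast _ _ _ _ (is_derive_damped _ _ _ _ _)).
  by rewrite !mulr1 !mulr0 !subr0.
have w1E (x : R) : is_derive x 1 (damped q k (- q) k)
    (damped q k (q ^+ 2 - k ^+ 2) (- (2 * q * k)) x).
  apply: (is_derive_cast _ _ _ _ (is_derive_damped _ _ _ _ _)).
  by rewrite /damped; ring.
have w2E (x : R) : is_derive x 1 (damped q k (q ^+ 2 - k ^+ 2) (- (2 * q * k)))
    (damped q k (3 * q * k ^+ 2 - q ^+ 3) (3 * q ^+ 2 * k - k ^+ 3) x).
  apply: (is_derive_cast _ _ _ _ (is_derive_damped _ _ _ _ _)).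
  by rewrite /damped; ring.
have w_0 : damped q k 1 0 0 = 0.
  by rewrite /damped [k * 0]mulr0 sin0; ring.
have w_L : damped q k 1 0 L = 0.
  by rewrite /damped kL; ring.
have w_B (x : R) : eps * damped q k (q ^+ 2 - k ^+ 2) (- (2 * q * k)) x
   - delta eps M / 2%:R * damped q k (- q) k x
   = (- eps * (k ^+ 2 + q ^+ 2)) * damped q k 1 0 x.
  rewrite q_delta /damped (_ : - (4 * eps * q) / 2%:R = - (2 * eps * q)); first by ring.
  by field.
have w_mu (x : R) :
   (- eps * (k ^+ 2 + q ^+ 2)) * damped q k (q ^+ 2 - k ^+ 2) (- (2 * q * k)) x
   - delta eps M / 2%:R
     * damped q k (3 * q * k ^+ 2 - q ^+ 3) (3 * q ^+ 2 * k - k ^+ 3) x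
   - M * damped q k (- q) k x = mode_rate k * damped q k 1 0 x.
  rewrite q_delta /mode_rate (_ : - (4 * eps * q) / 2%:R = - (2 * eps * q)).
    by rewrite q_M /damped; ring.
  by field.
exact: (@mode_adjoint_solution _ eps L M T _ _ _ _ _ _ (ltW T0) (ltW L0) w0E w1E w2E
  (continuous_damped _ _ _ _) w_0 w_L w_B w_mu).
Qed.

(** The defining identity of the solution at time T, tested with a mode: its left
    side is zero because the final state is. *)
Lemma null_control_moment (k : R) (y0 u : R -> R) : sin (k * L) = 0 ->
  k != 0 -> L2 0 L y0 -> null_controls eps T L M y0 u ->
  \int[leb]_(s in `]0, T[) (u s * expR (mode_rate k * (s - T)))
  = - (expR (- (mode_rate k * T)) / k
       * \int[leb]_(x in `]0, L[) (y0 x * damped q k 1 0 x)).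
Proof.
move=> kL k0 y02 [u2 [y [ysol yT]]].
have TT : T \in `[0, T]%R by rewrite in_itv/= lexx ltW.
have [yT2 yphi] := ysol T TT.
have cd := continuous_damped q k 1 0.
have d2 := continuous_L2 0 L _ cd.
have := yphi _ _ _ _ d2 (sine_adjoint_solution k kL).
have -> : \int[leb]_(x in `]0, L[) (y T x * damped q k 1 0 x) = 0.
  have yd := L2_mul_integrable _ _ _ _ yT2 d2.
  rewrite /Rintegral (@ae_eq_integral _ _ _ leb _ (cst 0%E))//; last 2 first.
  - exact: (measurable_int leb yd).
  - case: yT => N [mN N0 yN]; exists N; split => // x xN; apply: yN => yx0.
    by apply: xN => xL /=; rewrite yx0 ?mul0r.
  by rewrite integral0.
have e2 := continuous_L2 0 T _ (continuous_exp_shift (mode_rate k) T).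
rewrite sub0r mulrN.
rewrite (@eq_Rintegral _ _ _ leb _
  (fun x => expR (- (mode_rate k * T)) * (y0 x * damped q k 1 0 x))); last first.
  by move=> x _; rewrite mulrCA.
rewrite RintegralZl//; last exact: L2_mul_integrable.
have -> : \int[leb]_(s in `]0, T[)
      (u s * (expR (mode_rate k * (s - T)) * damped q k (- q) k 0))
    = k * \int[leb]_(s in `]0, T[) (u s * expR (mode_rate k * (s - T))).
  rewrite -RintegralZl//; last exact: L2_mul_integrable.
  (* the trace at 0 of the derivative of the mode is [k] *)
  apply: eq_Rintegral => s _.
  by rewrite /damped [k * 0]mulr0 sin0 cos0 [- q * 0]mulr0 expR0; ring.
move=> H; apply: (mulfI k0).
rewrite mulrN mulrA mulrCA divff// mulr1; lra.
Qed.

Definition wavenumber (k : nat) : R := k.+1%:R * (pi / L).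

Lemma wavenumber_gt0 k : 0 < wavenumber k.
Proof. by rewrite mulr_gt0// divr_gt0// pi_gt0. Qed.

Lemma wavenumber_lt : {homo wavenumber : i j / (i < j)%N >-> i < j}.
Proof. by move=> i j ij; rewrite ltr_pM2r ?ltr_nat// divr_gt0// pi_gt0. Qed.

Lemma mode_rate_lt (k l : R) : 0 <= k -> k < l -> mode_rate k < mode_rate l.
Proof.
move=> k0 kl; rewrite ltr_pM2l//.
have kl2 : k ^+ 2 < l ^+ 2 by rewrite ltr_pXn2r ?nnegrE// (le_trans k0)// ltW.
have k2 := sqr_ge0 k; have q2 := sqr_ge0 q.
by apply: ltr_pM; rewrite ?ltr_leD// addr_ge0// mulr_ge0.
Qed.

(** The weight exp(qx) cancels the one of the adjoint modes, so that the pairing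
    with them is that of sines. *)
Definition dual_mode (rho x : R) := rho * (expR (q * x) * sin (wavenumber 0 * x)).

Lemma continuous_dual_mode (rho : R) : continuous (dual_mode rho).
Proof.
have ce : continuous (fun x : R => expR (q * x)).
  apply: (is_derive_continuous _ (fun x => q * expR (q * x))) => x.
  by apply: is_derive_comp; exact: is_derive_mull.
apply: continuous_scale => x; apply: cvgM; first exact: ce.
exact: continuous_sin_mull.
Qed.

(** By orthogonality of the sines, the moments of a null control of the dual mode
    are exactly those required by [moment_bound]. *)
Lemma null_control_norm (a rho : R) (n : nat) (u : R -> R) : 0 <= a ->
  null_controls eps T L M (dual_mode rho) u ->
  ((expR (- (mode_rate (wavenumber 0) * T)) * (`|rho| * (L ^+ 2 / (2 * pi)))
    * Num.sqrt (2 * (mode_rate (wavenumber 0) + a))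
    * \prod_(k < n) ((mode_rate (wavenumber k.+1) + mode_rate (wavenumber 0) + 2 * a)
                     / (mode_rate (wavenumber k.+1) - mode_rate (wavenumber 0))))%:E
   <= L2norm 0 T u * (expR (a * T))%:E)%E.
Proof.
move=> a0 unull; have [u2 _] := unull.
have sinL k : sin (wavenumber k * L) = 0.
  by rewrite /wavenumber mulrA -mulrA mulVf ?mulr1 ?sin_natmul_pi// lt0r_neq0.
have y2 := continuous_L2 0 L _ (continuous_dual_mode rho).
have wn0 k : wavenumber k != 0 by rewrite lt0r_neq0// wavenumber_gt0.
have pairing k :
    \int[leb]_(x in `]0, L[) (dual_mode rho x * damped q (wavenumber k) 1 0 x)
    = rho * \int[leb]_(x in `]0, L[) (sin (wavenumber 0 * x) * sin (wavenumber k * x)).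
  rewrite -RintegralZl//.
    apply: eq_Rintegral => x _; rewrite /dual_mode /damped mulNr expRN.
    by field; rewrite lt0r_neq0 ?expR_gt0.
  by apply: L2_mul_integrable; apply: continuous_L2; exact: continuous_sin_mull.
have mom k := null_control_moment _ _ _ (sinL k) (wn0 k) y2 unull.
have rate_lt : {homo (fun k => mode_rate (wavenumber k)) : i j / (i < j)%N >-> i < j}.
  move=> i j ij; apply: mode_rate_lt; last exact: wavenumber_lt.
  by rewrite ltW// wavenumber_gt0.
have g0 : 0 < mode_rate (wavenumber 0).
  have w2 : 0 < wavenumber 0 ^+ 2 by rewrite exprn_gt0// wavenumber_gt0.
  have q2 := sqr_ge0 q.
  by rewrite /mode_rate; apply: mulr_gt0 => //; apply: mulr_gt0; lra.
have mom_eq0 k :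
    \int[leb]_(s in `]0, T[) (u s * expR (mode_rate (wavenumber k.+1) * (s - T))) = 0.
  rewrite mom pairing integral_sin_sin ?ltW// ?mulr0 ?oppr0//.
  by rewrite lt_eqF// ltr_pXn2r ?nnegrE ?ltW ?wavenumber_gt0// wavenumber_lt.
have := moment_bound T a (fun k => mode_rate (wavenumber k)) n u T0 a0 g0 rate_lt u2
  (fun k _ => mom_eq0 k).
rewrite /= (mom 0%N) (pairing 0%N) (integral_sin_sqr _ _ (ltW L0) (wn0 0%N) (sinL 0%N)).
rewrite normrN !normrM normfV (ger0_norm (expR_ge0 _)) (ger0_norm (ltW (wavenumber_gt0 0))).
rewrite (ger0_norm (ltW L0)) (@ger0_norm _ (2^-1)) ?invr_ge0//.
rewrite (_ : expR _ / _ * _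
  = expR (- (mode_rate (wavenumber 0) * T)) * (`|rho| * (L ^+ 2 / (2 * pi))))//.
rewrite -mulrA; congr (_ * _); rewrite /wavenumber.
move: (pi_gt0 R); move: (pi : R) => p p0; field.
by rewrite !lt0r_neq0.
Qed.

End NullControl.
End SineModes.

(** * The product over the wavenumbers *)

Section LogIntegral.
Local Open Scope classical_set_scope.
Context {R : realType}.

(** A primitive of ln (x^2 + c^2) up to the linear term 2x, which is left out because
    it cancels in the combination used below. *)
Definition log_primitive (c x : R) := x * ln (x ^+ 2 + c ^+ 2) + 2 * c * atan (x / c).

Lemma is_derive_log_primitive (c x : R) : 0 < c ->
  is_derive x 1 (log_primitive c) (ln (x ^+ 2 + c ^+ 2) + 2).
Proof.
move=> c0.
have pos : 0 < x ^+ 2 + c ^+ 2 by rewrite ltr_wpDl ?sqr_ge0// exprn_gt0.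
have sE : is_derive x 1 (fun y => y ^+ 2 + c ^+ 2) (2 * x).
  apply: (is_derive_cast _ _ _ _ (is_derive_add _ _ _ _ _
     (is_derive_mul _ _ _ _ _ (is_derive_id x 1) (is_derive_id x 1))
     (is_derive_cst (c ^+ 2) x 1))).
  by ring.
have lE : is_derive x 1 (fun y => ln (y ^+ 2 + c ^+ 2)) (2 * x * (x ^+ 2 + c ^+ 2)^-1).
  exact: (is_derive_comp (@ln R) (fun y => y ^+ 2 + c ^+ 2) _ _ x (is_derive1_ln pos) sE).
have dE : is_derive x 1 (fun y => y / c) c^-1.
  apply: (is_derive_cast _ _ _ _ (is_derive_mul _ _ _ _ _ (is_derive_id x 1)
    (is_derive_cst c^-1 x 1))).
  by rewrite mulr0 mulr1 add0r.
have aE : is_derive x 1 (fun y => atan (y / c)) (c^-1 * (1 + (x / c) ^+ 2)^-1).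
  exact: (is_derive_comp (@atan R) (fun y => y / c) _ _ x (is_derive1_atan (x / c)) dE).
apply: (is_derive_cast _ _ _ _ (is_derive_add _ _ _ _ _
   (is_derive_mul _ _ _ _ _ (is_derive_id x 1) lE) (is_derive_scale (2 * c) _ _ _ aE))).
have h : c ^+ 2 + x ^+ 2 != 0 by rewrite addrC lt0r_neq0.
by field; rewrite ?h ?lt0r_neq0 // expr1n mul1r.
Qed.

Lemma log_primitive_odd (c x : R) : log_primitive c (- x) = - log_primitive c x.
Proof. by rewrite /log_primitive sqrrN !mulNr atanN; ring. Qed.

(** In the variable x = k/m with m = 2|q|, the rate [mode_rate] of wavenumber k is
    eps m^4 times [rate_profile x + 5/16]. *)
Definition rate_profile (x : R) := x ^+ 4 + 3 / 2 * x ^+ 2.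

Lemma rate_profile_ge0 x : 0 <= rate_profile x.
Proof.
by rewrite /rate_profile; have := sqr_ge0 x; have := sqr_ge0 (x ^+ 2) => ? ?; lra.
Qed.

Section Primitive.
Variables (A b d eta : R).
Hypotheses (A0 : 0 < A) (b0 : 0 <= b) (d0 : 0 < d) (eta0 : 0 < eta).
Hypotheses (Ab : A ^+ 2 - b ^+ 2 = 3 / 4) (de : eta ^+ 2 + d ^+ 2 = 3 / 2).
Hypothesis beta_ge : (eta * d) ^+ 2 <= (A ^+ 2 + b ^+ 2) ^+ 2.

(** The parameters are chosen so that both terms of the fraction factor: the
    numerator is ((x - b)^2 + A^2) ((x + b)^2 + A^2) and the denominator is
    (x^2 + eta^2) (x^2 + d^2).  A small eta > 0, instead of 0, keeps the logarithm
    finite at the origin, at an arbitrarily small cost in the integral. *)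
Definition gap_ratio x :=
  (rate_profile x + (A ^+ 2 + b ^+ 2) ^+ 2) / (rate_profile x + (eta * d) ^+ 2).

Definition gap_primitive x := log_primitive A (x - b) + log_primitive A (x + b)
  - log_primitive eta x - log_primitive d x.

Let den_gt0 x : 0 < rate_profile x + (eta * d) ^+ 2.
Proof. by rewrite ltr_wpDl ?rate_profile_ge0// exprn_gt0// mulr_gt0. Qed.

Lemma gap_ratio_ge1 x : 1 <= gap_ratio x.
Proof. by rewrite ler_pdivlMr// mul1r lerD2l. Qed.

Lemma gap_ratio_nincr x y : 0 <= x -> x <= y -> gap_ratio y <= gap_ratio x.
Proof.
move=> x0 xy; rewrite ler_pdivrMr// mulrAC ler_pdivlMr//.
have Pxy : rate_profile x <= rate_profile y.
  by rewrite lerD// ?ler_wpM2l// lerXn2r ?nnegrE// (le_trans x0).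
rewrite -subr_ge0.
move: beta_ge; set B := (A ^+ 2 + b ^+ 2) ^+ 2; set G := (eta * d) ^+ 2 => GB.
rewrite (_ : _ - _ = (rate_profile y - rate_profile x) * (B - G)); last by ring.
by rewrite mulr_ge0 ?subr_ge0.
Qed.

Lemma ln_gap_ratio x : ln (gap_ratio x)
   = ln ((x - b) ^+ 2 + A ^+ 2) + ln ((x + b) ^+ 2 + A ^+ 2)
   - ln (x ^+ 2 + eta ^+ 2) - ln (x ^+ 2 + d ^+ 2).
Proof.
have pos (y c : R) : 0 < c -> y ^+ 2 + c ^+ 2 \is Num.pos.
  by move=> c0; rewrite posrE ltr_wpDl ?sqr_ge0// exprn_gt0.
have -> : gap_ratio x = (((x - b) ^+ 2 + A ^+ 2) * ((x + b) ^+ 2 + A ^+ 2))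
   / ((x ^+ 2 + eta ^+ 2) * (x ^+ 2 + d ^+ 2)).
  rewrite /gap_ratio /rate_profile; congr (_ / _).
    rewrite (_ : 3 / 2 = 2 * (A ^+ 2 - b ^+ 2)); first by ring.
    by rewrite Ab; field.
  by rewrite -de; ring.
by rewrite ln_div ?lnM ?posrE ?mulr_gt0 -?posrE ?pos//; ring.
Qed.

Lemma is_derive_gap_primitive (x : R) :
  is_derive x 1 gap_primitive (ln (gap_ratio x)).
Proof.
have shift (c : R) : is_derive x 1 (fun y => log_primitive A (y + c))
    (ln ((x + c) ^+ 2 + A ^+ 2) + 2).
  have sE : is_derive x 1 (fun y => y + c) 1.
    apply: (is_derive_cast _ _ _ _ (is_derive_add _ _ _ _ _ (is_derive_id x 1)
      (is_derive_cst c x 1))).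
    by rewrite addr0.
  apply: (is_derive_cast _ _ _ _ (is_derive_comp _ _ _ _ _
    (is_derive_log_primitive _ _ A0) sE)).
  by rewrite mul1r.
apply: (is_derive_cast _ _ _ _ (is_derive_sub _ _ _ _ _ (is_derive_sub _ _ _ _ _
  (is_derive_add _ _ _ _ _ (shift (- b)) (shift b))
  (is_derive_log_primitive _ _ eta0)) (is_derive_log_primitive _ _ d0))).
by rewrite ln_gap_ratio; ring.
Qed.

Lemma gap_primitive0 : gap_primitive 0 = 0.
Proof.
rewrite /gap_primitive sub0r add0r log_primitive_odd.
by rewrite /log_primitive !mul0r atan0 !mulr0; ring.
Qed.

(** In the primitive, the terms with logarithms add up to x ln (gap_ratio x) plus b
    times the logarithm of a ratio that is at least 1.  So only the arctangents
    remain, and those that are subtracted are at most pi/2. *)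
Lemma gap_primitive_ge (x : R) : 0 <= x ->
  4 * A * atan ((x - b) / A) - pi * (d + eta) <= gap_primitive x.
Proof.
move=> x0.
have hx : 0 <= x * ln (gap_ratio x) by rewrite mulr_ge0// ln_ge0// gap_ratio_ge1.
have hb : ln ((x - b) ^+ 2 + A ^+ 2) <= ln ((x + b) ^+ 2 + A ^+ 2).
  have h4 : 0 <= x * b by rewrite mulr_ge0.
  have hA : 0 < A ^+ 2 by rewrite exprn_gt0.
  by rewrite ler_ln ?posrE ?ltr_wpDl ?sqr_ge0//; nra.
have hat : atan ((x - b) / A) <= atan ((x + b) / A).
  by apply: le_atan; rewrite ler_pM2r ?invr_gt0 // lerD2l ge0_cp.
have pa (c y : R) : 0 < c -> 2 * c * atan y <= pi * c.
  by move=> c0; have H := ler_wpM2l (ltW c0) (ltW (atan_ltpi2 y)); lra.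
have hd := pa _ (x / d) d0; have he := pa _ (x / eta) eta0.
move: hx; rewrite ln_gap_ratio /gap_primitive /log_primitive => hx.
have hb2 := ler_wpM2l b0 hb.
have hat2 : 2 * A * atan ((x - b) / A) <= 2 * A * atan ((x + b) / A).
  by rewrite ler_wpM2l// mulr_ge0// ltW.
move: hx hb2 hat2 hd he.
set l1 := ln _; set l2 := ln _; set l3 := ln _; set l4 := ln _.
set a1 := atan _; set a2 := atan _; set a3 := atan _; set a4 := atan _.
move=> *; lra.
Qed.

(** A Riemann sum of a nonincreasing function dominates its integral. *)
Lemma prod_gap_ratio_ge (t : R) (n : nat) : 0 < t ->
  expR ((gap_primitive (n.+2%:R * t) - gap_primitive (2 * t)) / t)
  <= \prod_(k < n) gap_ratio (k.+2%:R * t).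
Proof.
move=> t0; elim: n => [|n IHn].
  by rewrite big_ord0 subrr mul0r expR0.
rewrite big_ord_recr/=.
have step : n.+2%:R * t <= n.+3%:R * t by rewrite ler_pM2r// ler_nat.
have [z zI Ez] := @MVT_segment _ _ _ _ _ step (fun x _ => is_derive_gap_primitive x)
  (continuous_subspaceT (is_derive_continuous _ _ is_derive_gap_primitive)).
have nt0 : 0 <= n.+2%:R * t by rewrite mulr_ge0// ltW.
have rz : ln (gap_ratio z) <= ln (gap_ratio (n.+2%:R * t)).
  rewrite ler_ln ?posrE ?(lt_le_trans ltr01 (gap_ratio_ge1 _))//.
  apply: gap_ratio_nincr => //; by move: zI; rewrite in_itv/= => /andP[].
rewrite (_ : _ / t = (gap_primitive (n.+2%:R * t) - gap_primitive (2 * t)) / t + ln (gap_ratio z)).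
  rewrite expRD ler_pM ?expR_ge0// -ler_ln ?posrE ?expR_gt0//;
    last exact: lt_le_trans ltr01 (gap_ratio_ge1 _).
  by rewrite expRK.
have {}Ez : gap_primitive (n.+3%:R * t) = gap_primitive (n.+2%:R * t) + ln (gap_ratio z) * t.
  rewrite addrC; apply/eqP; rewrite -subr_eq Ez; apply/eqP; congr (_ * _).
  by rewrite -mulrBl -natrB// subSnn mul1r.
by rewrite Ez; field; rewrite lt0r_neq0.
Qed.

End Primitive.
End LogIntegral.

(** * The lower bound for a fixed viscosity *)

Section ExplicitBound.
Local Open Scope classical_set_scope.
Context {R : realType}.
Local Notation leb := (@lebesgue_measure R).
Variables (A b d eta : R).
Hypotheses (A0 : 0 < A) (b0 : 0 <= b) (d0 : 0 < d) (eta0 : 0 < eta).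
Hypotheses (Ab : A ^+ 2 - b ^+ 2 = 3 / 4) (de : eta ^+ 2 + d ^+ 2 = 3 / 2).
Hypothesis beta_ge : (eta * d) ^+ 2 <= (A ^+ 2 + b ^+ 2) ^+ 2.
Variables (L T : R).
Hypotheses (L0 : 0 < L) (T0 : 0 < T).

(** As x tends to infinity and t to 0, the exponent tends to a limit that is at least
    the gap assumed positive: the arctangent in [gap_primitive_ge] tends to pi/2,
    and [gap_primitive] is continuous and vanishes at 0. *)
Lemma exponent_gap (th V al : R) : 0 <= V ->
  0 < L * (2 * A - d - eta) - th * L - V * (5 / 16 + al) ->
  exists c t0 x0 : R, [/\ 0 < c, 0 < t0 &
    forall t x : R, 0 < t -> t < t0 -> x0 <= x -> 0 <= x ->
    c <= L / pi * (gap_primitive A b d eta x - gap_primitive A b d eta (2 * t))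
         - th * L - V * (5 / 16 + al + 3 / 2 * t ^+ 2 + t ^+ 4)].
Proof.
move=> V0; set G := (X in 0 < X) => G0.
have p0 := pi_gt0 R.
(* the error on the arctangent that costs G / 4 in the exponent *)
pose e1 := G * pi / (16 * A * L).
have e10 : 0 < e1 by rewrite divr_gt0// mulr_gt0// mulr_gt0.
have [y0 y0P] : exists y : R, pi / 2 - e1 < atan y.
  have := @cvgy_atan R => /cvgrPdist_lt /(_ _ e10) [y [_ yP]].
  exists (y + 1); have := yP (y + 1); rewrite ltrDl => /(_ ltr01).
  by rewrite ltr_norml => /andP[_ ?]; lra.
pose K (t : R) := L / pi * gap_primitive A b d eta (2 * t) + V * (3 / 2 * t ^+ 2 + t ^+ 4).
have cK : continuous K.
  have cr : continuous (fun t : R => gap_primitive A b d eta (2 * t)).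
    apply: (is_derive_continuous _ (fun t => 2 * ln (gap_ratio A b d eta (2 * t)))) => t.
    apply: (is_derive_comp (gap_primitive A b d eta) (fun y => 2 * y)).
      exact: is_derive_gap_primitive.
    exact: is_derive_mull.
  move=> t; apply: cvgD; apply: cvgM; try exact: cvg_cst; first exact: cr.
  by apply: cvgD; [apply: cvgM; [exact: cvg_cst|]|]; exact: exprn_continuous.
have K0 : K 0 = 0 by rewrite /K [2 * 0]mulr0 gap_primitive0; ring.
have G4 : 0 < G / 4 by rewrite divr_gt0.
have := cK 0; rewrite /continuous_at K0 => /cvgrPdist_lt /(_ _ G4) [t0 /= t00 t0P].
exists (G / 2), t0, (A * y0 + b); split => //; first by rewrite divr_gt0.
move=> t x tp tt0 xx0 x0.
have Kt : K t < G / 4.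
  have := t0P t; rewrite /ball_ /= sub0r normrN gtr0_norm// => /(_ tt0).
  by rewrite sub0r normrN ltr_norml => /andP[].
have yx : y0 <= (x - b) / A by rewrite ler_pdivlMr//; lra.
have at_x : pi / 2 - e1 <= atan ((x - b) / A).
  exact: (le_trans (ltW y0P) (le_atan yx)).
have Hx := gap_primitive_ge A b d eta A0 b0 d0 eta0 Ab de beta_ge x x0.
have Hx2 : pi * (2 * A - d - eta) - 4 * A * e1 <= gap_primitive A b d eta x.
  have A4 : 0 <= 4 * A by rewrite mulr_ge0 ?ltW.
  have := ler_wpM2l A4 at_x => ?; lra.
have Lp : 0 <= L / pi by rewrite divr_ge0// ltW.
have := ler_wpM2l Lp Hx2.
have -> : L / pi * (pi * (2 * A - d - eta) - 4 * A * e1) = L * (2 * A - d - eta) - G / 4.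
  rewrite /e1; move: (pi : R) p0 => p p0; field.
  by rewrite !lt0r_neq0.
move: Kt; rewrite /K => Kt.
have -> : L * (2 * A - d - eta) = G + th * L + V * (5 / 16 + al) by rewrite /G; ring.
move=> ?; lra.
Qed.

Lemma dual_mode_unit (q rho : R) : 0 <= rho ->
  (forall x, 0 < x < L -> rho * expR (q * x) <= (Num.sqrt L)^-1) ->
  L2 0 L (dual_mode L q rho) /\ (L2norm 0 L (dual_mode L q rho) <= 1)%E.
Proof.
move=> rho0 rho_le.
have cy := continuous_dual_mode L q rho.
have y2 := continuous_L2 0 L _ cy; split => //.
rewrite /L2norm Lnorm2_sqrt// lee_fin -[leRHS]sqrtr1 ler_wsqrtr//.
have oi (f : R -> R) : continuous f -> leb.-integrable `]0, L[ (EFin \o f).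
  by move=> cf; exact/L2_integrable/continuous_L2.
apply: (@le_trans _ _ (\int[leb]_(x in `]0, L[) (L^-1))).
  apply: le_Rintegral => //.
  - exact/oi/continuous_sqr.
  - by apply: oi => x; exact: cvg_cst.
  - move=> x /=; rewrite in_itv/= => xL.
    rewrite -real_normK ?num_real//.
    have -> : L^-1 = (Num.sqrt L)^-1 ^+ 2 by rewrite exprVn sqr_sqrtr ?ltW.
    rewrite lerXn2r ?nnegrE ?invr_ge0 ?sqrtr_ge0//.
    rewrite /dual_mode mulrA normrM; apply: le_trans (rho_le x xL).
    rewrite ger0_norm ?mulr_ge0 ?expR_ge0// ler_piMr ?mulr_ge0 ?expR_ge0//.
    by rewrite ler_norml sin_geN1 sin_le1.
rewrite Rintegral_cst//= [X in fine X](_ : _ = L%:E).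
  by rewrite /= mulVf// lt0r_neq0.
by rewrite (lebesgue_measure_itv (`]0, L[%R : interval R))/= lte_fin L0 oppr0 adde0.
Qed.

(** The wavenumber number k, in units of m, is k.+1%:R * t.  In [q_th], th L m bounds
    the exponent of the weight exp(qx) of the initial datum. *)
Section Cost.
Variables (eps M q m m0 th al : R).
Hypotheses (eps0 : 0 < eps) (m00 : 0 < m0) (m0m : m0 <= m).
Hypotheses (q_delta : delta eps M = - (4 * eps * q)) (q_M : M = 8 * eps * q ^+ 3).
Hypotheses (q_m : q ^+ 2 = m ^+ 2 / 4) (eps_m : eps * m ^+ 3 = `|M|).
Hypotheses (M0 : M != 0) (al0 : 0 <= al)
  (al_beta : (A ^+ 2 + b ^+ 2) ^+ 2 <= 5 / 8 + 2 * al).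
Hypothesis q_th : forall x, 0 < x < L -> q * x <= th * L * m.

Let t := pi / (L * m).

(** [null_control_norm] with the shift a = al |M| m, where each factor of its product
    is bounded below by a value of [gap_ratio]: the term nu_0 in the denominator
    nu_k - nu_0 cancels the constant 5/16 of the rate and is dropped otherwise. *)
Lemma cost_ge_prod (n : nat) :
  ((L ^+ 2 / (2 * pi) / Num.sqrt L * Num.sqrt (2 * (`|M| * m0 * (5 / 16)))
    * expR (- (m * (th * L + `|M| * T * (5 / 16 + al + 3 / 2 * t ^+ 2 + t ^+ 4))))
    * \prod_(k < n) gap_ratio A b d eta (k.+2%:R * t))%:E
   <= control_cost eps T L M)%E.
Proof.
have m_gt0 : 0 < m by exact: lt_le_trans m0m.
have aM : 0 < `|M| by rewrite normr_gt0.
have p0 := pi_gt0 R.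
have sL : 0 < Num.sqrt L by rewrite sqrtr_gt0.
pose rho := expR (- (th * L * m)) / Num.sqrt L.
have rho0 : 0 < rho by rewrite divr_gt0// expR_gt0.
have rhoP x : 0 < x < L -> rho * expR (q * x) <= (Num.sqrt L)^-1.
  move=> xL; rewrite /rho mulrAC -expRD ler_piMl ?invr_ge0 ?sqrtr_ge0//.
  by rewrite -[leRHS]expR0 ler_expR addrC subr_le0 q_th.
have [y2 y1] := dual_mode_unit q rho (ltW rho0) rhoP.
apply: le_ereal_sup_tmp; eexists; first by exists (dual_mode L q rho).
apply: le_ereal_inf_tmp => _ [u unull <-].
have mode_rateE k : mode_rate eps q (wavenumber L k)
    = `|M| * m * (rate_profile (k.+1%:R * t) + 5 / 16).
  rewrite /mode_rate /wavenumber (_ : pi / L = m * t); last first.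
    by rewrite /t; move: (pi : R) => p; field; rewrite !lt0r_neq0.
  by rewrite q_m -eps_m /rate_profile; field.
pose a := al * `|M| * m.
have a0 : 0 <= a by rewrite !mulr_ge0// ltW.
have := @null_control_norm R eps T L M q eps0 T0 L0 q_delta q_M a rho n u a0 unull.
set X := (X in (X%:E <= _)%E) => XN.
have XN' : ((X * expR (- (a * T)))%:E <= L2norm 0 T u)%E.
  have := lee_wpmul2r (x := (expR (- (a * T)))%:E) _ XN.
  rewrite -muleA -!EFinM -expRD subrr expR0 mule1; apply.
  by rewrite lee_fin expR_ge0.
apply: le_trans XN'; rewrite lee_fin /X.
have -> : L ^+ 2 / (2 * pi) / Num.sqrt L * Num.sqrt (2 * (`|M| * m0 * (5 / 16)))
    * expR (- (m * (th * L + `|M| * T * (5 / 16 + al + 3 / 2 * t ^+ 2 + t ^+ 4))))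
    * \prod_(k < n) gap_ratio A b d eta (k.+2%:R * t)
  = (expR (- (mode_rate eps q (wavenumber L 0) * T)) * (`|rho| * (L ^+ 2 / (2 * pi)))
     * expR (- (a * T)))
    * (Num.sqrt (2 * (`|M| * m0 * (5 / 16)))
       * \prod_(k < n) gap_ratio A b d eta (k.+2%:R * t)).
  rewrite (ger0_norm (ltW rho0)) /rho.
  have -> : expR (- (m * (th * L + `|M| * T * (5 / 16 + al + 3 / 2 * t ^+ 2 + t ^+ 4))))
     = expR (- (mode_rate eps q (wavenumber L 0) * T)) * expR (- (th * L * m))
       * expR (- (a * T)).
    by rewrite -!expRD mode_rateE mul1r /rate_profile /a; congr expR; ring.
  ring.
rewrite [leRHS](_ : _ =
    (expR (- (mode_rate eps q (wavenumber L 0) * T)) * (`|rho| * (L ^+ 2 / (2 * pi)))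
     * expR (- (a * T)))
    * (Num.sqrt (2 * (mode_rate eps q (wavenumber L 0) + a))
       * \prod_(k < n)
           ((mode_rate eps q (wavenumber L k.+1) + mode_rate eps q (wavenumber L 0) + 2 * a)
            / (mode_rate eps q (wavenumber L k.+1) - mode_rate eps q (wavenumber L 0)))));
  last by ring.
have Mm : 0 < `|M| * m by rewrite mulr_gt0.
apply: ler_wpM2l.
  by rewrite !mulr_ge0 ?expR_ge0 ?invr_ge0 ?sqr_ge0 ?mulr_ge0// ltW.
apply: ler_pM; rewrite ?sqrtr_ge0//.
- by apply: prodr_ge0 => k _; rewrite (le_trans ler01)// gap_ratio_ge1.
- rewrite ler_wsqrtr// ler_pM2l// mode_rateE -[leLHS]addr0 lerD//.
  apply: (@le_trans _ _ (`|M| * m * (5 / 16))).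
    by rewrite ler_pM2r// ler_pM2l.
  by rewrite ler_pM2l// lerDr rate_profile_ge0.
- apply: ler_prod => k _.
  have den : 0 < mode_rate eps q (wavenumber L k.+1) - mode_rate eps q (wavenumber L 0).
    rewrite subr_gt0; apply: mode_rate_lt => //; first by rewrite ltW// wavenumber_gt0.
    exact: wavenumber_lt.
  rewrite (le_trans ler01) ?gap_ratio_ge1//=.
  rewrite ler_pdivlMr// mulrC !mode_rateE mul1r /gap_ratio.
  set p := rate_profile (k.+2%:R * t).
  have p_ge0 : 0 <= p by exact: rate_profile_ge0.
  have G0 : 0 < p + (eta * d) ^+ 2 by rewrite ltr_wpDl// exprn_gt0// mulr_gt0.
  rewrite mulrA ler_pdivrMr//.
  apply: (@le_trans _ _ (`|M| * m * (p + (eta * d) ^+ 2)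
                         * (p + (A ^+ 2 + b ^+ 2) ^+ 2))).
    apply: ler_wpM2r; first by rewrite addr_ge0 ?sqr_ge0.
    rewrite -mulrBr ler_pM2l//.
    by have := rate_profile_ge0 t; have := sqr_ge0 (eta * d) => ? ?; lra.
  rewrite -mulrA [leRHS]mulrC mulrCA ler_wpM2l ?(ltW G0)//.
  rewrite (_ : _ + _ + 2 * a = `|M| * m * (p + rate_profile t + 5 / 8 + 2 * al));
    last by rewrite /a; field.
  rewrite ler_pM2l//.
  by move: p (rate_profile t) (rate_profile_ge0 t) al_beta {G0 p_ge0} => p1 p2 ? ?; lra.
Qed.

End Cost.

End ExplicitBound.

(** * Uniformity in the viscosity *)

Section Assembly.
Local Open Scope classical_set_scope.
Context {R : realType}.

Lemma cbrtK (x : R) : cbrt x ^+ 3 = x.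
Proof.
rewrite /cbrt exprMn -(powR_mulrn 3 (powR_ge0 _ _)) -powRrM mulVf ?pnatr_eq0//.
rewrite powRr1//; case: sgrP => [->|_|_]; first by rewrite mulr0.
  by rewrite expr1n mul1r.
by rewrite exprS sqrrN expr1n mulr1 mulN1r opprK.
Qed.

Lemma cbrt_gt0 (x : R) : (0 < cbrt x) = (0 < x).
Proof.
rewrite /cbrt; have [->|x0] := eqVneq x 0; first by rewrite sgr0 mul0r.
by rewrite pmulr_lgt0 ?sgr_gt0// powR_gt0// normr_gt0.
Qed.

Lemma delta_cbrt (eps M : R) : 0 < eps ->
  let q := cbrt M / (2 * eps `^ (1 / 3)) in
  delta eps M = - (4 * eps * q) /\ M = 8 * eps * q ^+ 3.
Proof.
move=> eps0 /=; set e3 := eps `^ (1 / 3).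
have e30 : 0 < e3 by rewrite powR_gt0.
have e33 : eps = e3 ^+ 3.
  by rewrite -(powR_mulrn _ (powR_ge0 _ _)) -powRrM mul1r mulVf ?pnatr_eq0// powRr1// ltW.
have e32 : eps `^ (2%:R / 3%:R) = e3 ^+ 2.
  by rewrite -(powR_mulrn _ (powR_ge0 _ _)) -powRrM; congr (_ `^ _); field.
split.
  by rewrite /delta e32 e33; field; rewrite lt0r_neq0.
rewrite -[LHS](cbrtK M) [in RHS]e33; field.
by rewrite lt0r_neq0.
Qed.

(** For eps small, enough factors of the product are taken for [exponent_gap] to
    apply.  The remaining eps stay away from 0, so that m is bounded, and the bound
    with an empty product suffices after decreasing the constant C. *)
Lemma cost_exponential (A b d eta M L T th al : R)
  (A0 : 0 < A) (b0 : 0 <= b) (d0 : 0 < d) (eta0 : 0 < eta)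
  (Ab : A ^+ 2 - b ^+ 2 = 3 / 4) (de : eta ^+ 2 + d ^+ 2 = 3 / 2)
  (beta_ge : (eta * d) ^+ 2 <= (A ^+ 2 + b ^+ 2) ^+ 2)
  (M0 : M != 0) (L0 : 0 < L) (T0 : 0 < T) (al0 : 0 <= al) (th0 : 0 <= th)
  (al_beta : (A ^+ 2 + b ^+ 2) ^+ 2 <= 5 / 8 + 2 * al)
  (th_M : cbrt M <= 2 * th * `|cbrt M|)
  (gap : 0 < L * (2 * A - d - eta) - th * L - `|M| * T * (5 / 16 + al)) :
  exists c C : R, [/\ 0 < c, 0 < C &
    forall eps : R, 0 < eps -> eps < 1 ->
      ((C * expR (c * eps `^ (- (1 / 3%:R))))%:E <= control_cost eps T L M)%E].
Proof.
have MT0 : 0 <= `|M| * T by rewrite mulr_ge0// ltW.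
have p0 := pi_gt0 R.
have [c0 [t0 [x0 [c00 t00 cP]]]] :=
  exponent_gap A b d eta A0 b0 d0 eta0 Ab de beta_ge L L0 th (`|M| * T) al MT0 gap.
pose m0 : R := `|cbrt M|.
have m00 : 0 < m0.
  rewrite normr_gt0; apply: contra M0 => /eqP cM0.
  by rewrite -(cbrtK M) cM0 expr0n.
pose F := L ^+ 2 / (2 * pi) / Num.sqrt L * Num.sqrt (2 * (`|M| * m0 * (5 / 16))).
have F0 : 0 < F.
  apply: mulr_gt0.
    apply: divr_gt0; last by rewrite sqrtr_gt0.
    by apply: divr_gt0; [exact: exprn_gt0|exact: mulr_gt0].
  rewrite sqrtr_gt0; apply: mulr_gt0 => //; apply: mulr_gt0; last by lra.
  by apply: mulr_gt0 => //; rewrite normr_gt0.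
pose expo t := th * L + `|M| * T * (5 / 16 + al + 3 / 2 * t ^+ 2 + t ^+ 4).
pose m1 := pi / (L * t0).
have m10 : 0 < m1 by rewrite divr_gt0// mulr_gt0.
pose tmax := pi / (L * m0).
have expo_ge0 t : 0 <= expo t.
  apply: addr_ge0; first by rewrite mulr_ge0// ltW.
  apply: mulr_ge0 => //.
  by have := sqr_ge0 t; have := sqr_ge0 (t ^+ 2) => ? ?; lra.
exists (c0 * m0), (F * expR (- (m1 * (expo tmax + c0)))); split.
- by rewrite mulr_gt0.
- by rewrite mulr_gt0// expR_gt0.
move=> eps eps0 eps1.
set e3 := eps `^ (1 / 3%:R).
have e30 : 0 < e3 by rewrite powR_gt0.
have e31 : e3 <= 1.
  apply: (@le_trans _ _ (1 `^ (1 / 3%:R))); last by rewrite powR1.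
  by apply: ge0_ler_powR; rewrite ?nnegrE ?ler01 ?divr_ge0//; exact: ltW.
have e33 : e3 ^+ 3 = eps.
  by rewrite -(powR_mulrn _ (powR_ge0 _ _)) -powRrM mul1r mulVf ?pnatr_eq0// powRr1// ltW.
rewrite powRN -/e3.
have [q_delta q_M] := delta_cbrt eps M eps0.
set q := cbrt M / _ in q_delta q_M.
pose m := m0 / e3.
have m0m : m0 <= m by rewrite ler_pdivlMr// ler_piMr// ltW.
have m_gt0 : 0 < m by exact: lt_le_trans m0m.
have q_m : q ^+ 2 = m ^+ 2 / 4.
  rewrite [m ^+ 2]exprMn [m0 ^+ 2]real_normK ?num_real// /q -/e3; move: (cbrt M) => s; field.
  by rewrite lt0r_neq0.
have eps_m : eps * m ^+ 3 = `|M|.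
  rewrite /m exprMn exprVn e33 mulrCA divff ?mulr1 ?lt0r_neq0//.
  by rewrite /m0 -normrX cbrtK.
have q_th x : 0 < x < L -> q * x <= th * L * m.
  move=> /andP[xp xL].
  have qm : q <= th * m.
    rewrite /q -/e3 /m mulrA ler_pdivrMr ?mulr_gt0//.
    rewrite (_ : _ * (2 * e3) = 2 * th * m0) ?th_M//; field.
    by rewrite lt0r_neq0.
  apply: (@le_trans _ _ (th * m * x)); first by rewrite ler_wpM2r// ltW.
  by have h := ler_wpM2l (mulr_ge0 th0 (ltW m_gt0)) (ltW xL); lra.
have prod_le := cost_ge_prod A b d eta d0 eta0 beta_ge L T L0 T0
  eps M q m m0 th al eps0 m00 m0m q_delta q_M q_m eps_m M0 al0 al_beta q_th.
set t := pi / (L * m) in prod_le.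
have t_gt0 : 0 < t by rewrite divr_gt0// mulr_gt0.
have tL : t^-1 = L / pi * m.
  by rewrite /t; move: (pi : R) p0 => p p0; field; rewrite !lt0r_neq0.
rewrite -/F -/(expo t) in prod_le.
have -> : c0 * m0 * e3^-1 = c0 * m by rewrite /m mulrA.
have [m1m|mm1] := ltP m1 m.
- have tt0 : t < t0.
    have Lm : 0 < L * m by exact: mulr_gt0.
    have Lt0 : 0 < L * t0 by exact: mulr_gt0.
    by move: m1m; rewrite /m1 /t (ltr_pdivrMr _ _ Lt0) (ltr_pdivrMr _ _ Lm) => h; lra.
  pose n := Num.bound (`|x0| / t).
  have nx : `|x0| <= n.+2%:R * t.
    rewrite -ler_pdivrMr//; apply: ltW; apply: (lt_trans (archi_boundP _)).
      by rewrite divr_ge0// ltW.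
    by rewrite ltr_nat ltnS leqW.
  have gapP := cP t (n.+2%:R * t) t_gt0 tt0 (le_trans (ler_norm _) nx)
    (le_trans (normr_ge0 _) nx).
  apply: le_trans (prod_le n); rewrite lee_fin -!(mulrA F) ler_wpM2l ?(ltW F0)//.
  apply: (@le_trans _ _ (expR (- (m * expo t)) *
     expR ((gap_primitive A b d eta (n.+2%:R * t) - gap_primitive A b d eta (2 * t)) / t)));
    last first.
    apply: ler_wpM2l; [exact: expR_ge0|exact: prod_gap_ratio_ge].
  rewrite -!expRD ler_expR tL /expo.
  have h1 : 0 <= m1 * (expo tmax + c0).
    by apply: mulr_ge0; [exact: ltW|apply: addr_ge0 => //; exact: ltW].
  rewrite /expo in h1.
  have := ler_wpM2l (ltW m_gt0) gapP => h2; lra.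
- apply: le_trans (prod_le 0%N); rewrite big_ord0 mulr1 lee_fin.
  rewrite -(mulrA F) ler_wpM2l ?(ltW F0)// -expRD ler_expR.
  have ttmax : t <= tmax.
    have Lm : 0 < L * m by exact: mulr_gt0.
    have Lm0 : 0 < L * m0 by exact: mulr_gt0.
    by rewrite /t /tmax ler_pM2l// lef_pV2 ?posrE// ler_pM2l.
  have expo_le : expo t <= expo tmax.
    rewrite lerD2l ler_wpM2l// !lerD//.
      by rewrite ler_wpM2l// lerXn2r ?nnegrE ?(ltW t_gt0)// (le_trans (ltW t_gt0)).
    by rewrite lerXn2r ?nnegrE ?(ltW t_gt0)// (le_trans (ltW t_gt0)).
  have h1 : m * expo t <= m1 * expo tmax by rewrite ler_pM// ltW.
  have h2 : c0 * m <= c0 * m1 by rewrite ler_pM2l.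
  lra.
Qed.

End Assembly.

(** The value of eta only has to be small.  The theorem leaves just enough room for
    replacing d by its bound 49/40, and sqrt(5/8) by 79/100 when M < 0, which makes
    A^2 and b^2 rational; 193/220 is a lower bound for A. *)
Theorem theorem4 (R : realType) (M L T : R)
  (hM : M != 0) (hL : 0 < L) (hT : 0 < T)
  (hpos : 0 < M -> T < 33%:R / 100%:R * (L / M))
  (hneg : M < 0 -> T < 169%:R / 100%:R * (L / `|M|)) :
  exists c C : R, [/\ 0 < c, 0 < C &
    forall eps : R, 0 < eps -> eps < 1 ->
      ((C * expR (c * eps `^ (- (1 / 3%:R))))%:E <= control_cost eps T L M)%E].
Proof.
pose eta : R := 1 / 1000; pose d := Num.sqrt (3 / 2 - eta ^+ 2).
have eta0 : 0 < eta by rewrite /eta; lra.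
have d2 : d ^+ 2 = 3 / 2 - eta ^+ 2 by rewrite sqr_sqrtr// /eta; lra.
have d0 : 0 < d by rewrite sqrtr_gt0 /eta; lra.
have d_le : d <= 49 / 40.
  rewrite -ler_sqr ?nnegrE; [by rewrite d2 /eta; lra|exact: ltW|lra].
have de : eta ^+ 2 + d ^+ 2 = 3 / 2 by rewrite d2; lra.
have [M_lt0|M_gt0|M_eq0] := ltgtP M 0; last by rewrite M_eq0 eqxx in hM.
- pose A : R := Num.sqrt (77 / 100); pose b : R := Num.sqrt (2 / 100).
  have A2 : A ^+ 2 = 77 / 100 by rewrite sqr_sqrtr//; lra.
  have b2 : b ^+ 2 = 2 / 100 by rewrite sqr_sqrtr//; lra.
  have A0 : 0 < A by rewrite sqrtr_gt0; lra.
  have A_ge : 193 / 220 <= A.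
    rewrite -ler_sqr ?nnegrE; [by rewrite A2; lra|lra|exact: ltW].
  have MT : `|M| * T < 169 / 100 * L.
    have := hneg M_lt0; rewrite mulrA ltr_pdivlMr ?normr_gt0// => ?; lra.
  apply: (cost_exponential A b d eta M L T 0 0) => //.
  + exact: sqrtr_ge0.
  + by rewrite A2 b2; lra.
  + by rewrite A2 b2 exprMn d2 /eta; lra.
  + by rewrite A2 b2; lra.
  + by rewrite mulr0 mul0r leNgt cbrt_gt0 -leNgt ltW.
  + have h1 := ler_wpM2l (ltW hL) A_ge; have h2 := ler_wpM2l (ltW hL) d_le.
    rewrite /eta; lra.
- have MT : `|M| * T < 33 / 100 * L.
    rewrite gtr0_norm//; have := hpos M_gt0; rewrite mulrA ltr_pdivlMr// => ?; lra.
  have al_beta : (1 ^+ 2 + (1 / 2) ^+ 2) ^+ 2 <= 5 / 8 + 2 * (15 / 32) :> R by lra.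
  apply: (cost_exponential 1 (1 / 2) d eta M L T (1 / 2) (15 / 32)); try by [].
  + by lra.
  + by rewrite exprMn d2 /eta; lra.
  + by rewrite (_ : 2 * (1 / 2) = 1) ?mul1r ?ler_norm//; lra.
  + have h2 := ler_wpM2l (ltW hL) d_le.
    by rewrite /eta; lra.
Qed.
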